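(* Let $d\in\mathbb N$, equip $\mathbb R^d$ with the scaling $\mathfrak s=(1,\dots,1)$, and let $0<\alpha<1<\eta<2$. There exists a constant $C>0$ such that for all germs $U$ over $\mathbb R^d$ with $\|U\|_{G^{\eta}(\mathbb R^d)}<\infty$ it holds $$\|U\|_{G^{\eta}(\mathbb R^d)}\le C\big([\Delta U]_{G^{\eta-2}(\mathbb R^d)}+[U]_{G^{\eta,\alpha}(\mathbb R^d)}\big),$$ where $\Delta$ is the Laplacian.
   Context: For a scaling $\mathfrak s\in\mathbb N^d$ and a multi-index $\beta\in\mathbb N_0^d$ set $|\beta|:=\sum_i\mathfrak s_i\beta_i$. The (anisotropic) distance is $d(x,y):=\sum_{i=1}^d|x_i-y_i|^{1/\mathfrak s_i}$ and $B_R(x)$ is the open ball for $d$. For an integer $k$, $\mathcal P_k$ denotes the polynomials $\sum_{|\beta|\le k}c_\beta z^\beta$ on $\mathbb R^d$. A germ over $D\subseteq\mathbb R^d$ is a family $U=(U_x)_{x\in D}$ of continuous functions $U_x:D\to\mathbb C$. For $\eta>0$, $\|U\|_{G^\eta(D)}$ is the infimum of all $M>0$ with $|U_x(y)|\le M\,d(x,y)^\eta$ for all $x,y\in D$. For $0<\alpha<\eta$, $[U]_{G^{\eta,\alpha}(D)}$ is the infimum of all $M>0$ such that for all $x,y\in D$ there is $P\in\mathcal P_{\lfloor\eta\rfloor}$ with $|(U_x-U_y-P)(z)|\le M\,d(y,z)^\alpha(d(x,y)+d(y,z))^{\eta-\alpha}$ for all $z\in D$. For $\gamma<0$, let $k:=\lceil|\gamma|\rceil$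 (absolute value) and let $\mathcal B$ be the set of $\varphi\in C_c^\infty(\mathbb R^d)$ with $\operatorname{supp}\varphi\subseteq B_1(0)$ and $\sup_{|\beta|\le k}\sup|\partial^\beta\varphi|\le 1$. For $x\in\mathbb R^d,\lambda>0$ put $\varphi_x^\lambda(y):=\lambda^{-\sum_i\mathfrak s_i}\varphi(\lambda^{-\mathfrak s_1}(y_1-x_1),\dots,\lambda^{-\mathfrak s_d}(y_d-x_d))$. For an open $D$ and a family $V=(V_x)_{x\in D}$ of distributions $V_x\in\mathcal D'(D)$ (a distribution-valued germ), $[V]_{G^\gamma(D)}:=\sup_{\varphi\in\mathcal B}\sup_{x\in D}\sup_{\lambda>0,\,B_\lambda(x)\subseteq D}\lambda^{-\gamma}|\langle V_x,\varphi_x^\lambda\rangle|$. For a differential operator $\mathcal L$, $\mathcal LU$ denotes the distribution-valued germ $(\mathcal L U_x)_{x}$, with $\mathcal L$ acting distributionally in the active variable (the base point fixed). *)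

(* Defs.v *)
From HB Require Import structures.
From mathcomp Require Import all_boot all_order all_algebra.
From mathcomp Require Import all_classical all_reals all_analysis.
From mathcomp Require Import complex.
Set Implicit Arguments. Unset Strict Implicit. Unset Printing Implicit Defensive.
Import Order.TTheory GRing.Theory Num.Theory.
Import numFieldNormedType.Exports.
Local Open Scope classical_set_scope.
Local Open Scope ring_scope.

Section Defs.
Variable R : realType.

(** Points of R^d are row vectors 'rV[R]_d (standard topology).
    The scaling is s = (1,...,1), so |beta| = sum_i beta_i and the
    anisotropic distance is the l^1 distance. *)
Definition dist (d : nat) (x y : 'rV[R]_d) : R := \sum_(i < d) `|x 0 i - y 0 i|.

Definition dball (d : nat) (x : 'rV[R]_d) (r : R) : set 'rV[R]_d :=
  [set y | dist x y < r].

Definition evec (d : nat) (i : 'I_d) : 'rV[R]_d := delta_mx 0 i.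

Definition partial (d : nat) (i : 'I_d) (f : 'rV[R]_d -> R) : 'rV[R]_d -> R :=
  fun x => derive f x (evec i).

Definition iter_partial (d : nat) (s : seq 'I_d) (f : 'rV[R]_d -> R) :=
  foldr (fun i g => partial i g) f s.

Definition smooth (d : nat) (f : 'rV[R]_d -> R) : Prop :=
  (forall s : seq 'I_d, continuous (iter_partial s f)) /\
  (forall (s : seq 'I_d) (i : 'I_d) (x : 'rV[R]_d),
      derivable (iter_partial s f) x (evec i)).

Definition mindex_size (d : nat) (b : 'I_d -> nat) : nat := \sum_(i < d) b i.
Definition dmulti (d : nat) (b : 'I_d -> nat) (f : 'rV[R]_d -> R) :=
  iter_partial (flatten [seq nseq (b i) i | i <- enum 'I_d]) f.

Definition laplace (d : nat) (f : 'rV[R]_d -> R) : 'rV[R]_d -> R :=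
  fun x => \sum_(i < d) partial i (partial i f) x.

Definition testB (d : nat) (k : nat) (phi : 'rV[R]_d -> R) : Prop :=
  smooth phi /\
  closure [set y | phi y != 0] `<=` dball 0 1 /\
  (forall (b : 'I_d -> nat) (y : 'rV[R]_d),
      (mindex_size b <= k)%N -> `|dmulti b phi y| <= 1).

Definition rescale (d : nat) (phi : 'rV[R]_d -> R) (x : 'rV[R]_d) (lam : R) :
  'rV[R]_d -> R := fun y => lam ^- d * phi (lam^-1 *: (y - x)).

(** Lebesgue integral over R^d, written as an iterated integral over the
    coordinates (for the continuous compactly supported integrands below this
    is the d-dimensional Lebesgue integral by Fubini). *)
Fixpoint intRd (d : nat) : ('rV[R]_d -> R) -> R :=
  match d return ('rV[R]_d -> R) -> R with
  | 0 => fun f => f 0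
  | d'.+1 => fun f =>
      Rintegral (@lebesgue_measure R) setT
        (fun t : R => intRd (fun y : 'rV[R]_d' => f (row_mx (t%:M : 'rV[R]_1) y)))
  end.

Definition germ (d : nat) (U : 'rV[R]_d -> 'rV[R]_d -> R[i]) : Prop :=
  forall x, continuous (fun y => complex.Re (U x y)) /\ continuous (fun y => complex.Im (U x y)).

Definition normG (d : nat) (eta : R) (U : 'rV[R]_d -> 'rV[R]_d -> R[i]) : \bar R :=
  ereal_inf [set M%:E | M in [set M : R | 0 < M /\
     forall x y, Normc.normc (U x y) <= M * dist x y `^ eta]].

Definition polyP (d k : nat) (c : {ffun 'I_d -> 'I_k.+1} -> R[i])
  (z : 'rV[R]_d) : R[i] :=
  \sum_(b : {ffun 'I_d -> 'I_k.+1} | (\sum_(i < d) (b i : nat) <= k)%N)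
     c b * \prod_(i < d) ((z 0 i)%:C)%C ^+ (b i : nat).

Definition seminormGA (d : nat) (eta alpha : R)
  (U : 'rV[R]_d -> 'rV[R]_d -> R[i]) : \bar R :=
  ereal_inf [set M%:E | M in [set M : R | 0 < M /\
     forall x y, exists c : {ffun 'I_d -> 'I_(`|Num.floor eta|%N).+1} -> R[i],
       forall z, Normc.normc (U x z - U y z - polyP c z)
          <= M * dist y z `^ alpha * (dist x y + dist y z) `^ (eta - alpha)]].

(** distribution-valued germ: V x is a distribution, given by its action on
    (real) test functions. [V]_{G^gamma(R^d)} for gamma < 0 (D = R^d, so the
    condition B_lambda(x) subset D is automatic). *)
Definition seminormG (d : nat) (gamma : R)
  (V : 'rV[R]_d -> ('rV[R]_d -> R) -> R[i]) : \bar R :=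
  ereal_sup [set e : \bar R | exists (phi : 'rV[R]_d -> R) (x : 'rV[R]_d) (lam : R),
     [/\ testB `|Num.ceil `|gamma| |%N phi, 0 < lam &
        e = (lam `^ (- gamma) * Normc.normc (V x (rescale phi x lam)))%:E]].

Definition lapGerm (d : nat) (U : 'rV[R]_d -> 'rV[R]_d -> R[i]) :
  'rV[R]_d -> ('rV[R]_d -> R) -> R[i] :=
  fun x psi => Complex (intRd (fun y => complex.Re (U x y) * laplace psi y))
                       (intRd (fun y => complex.Im (U x y) * laplace psi y)).

End Defs.

(* Main.v *)
Require Import Defs.
From HB Require Import structures.
From mathcomp Require Import all_boot all_order all_algebra.
From mathcomp Require Import all_classical all_reals all_analysis.
From mathcomp Require Import complex ring lra.
Set Implicit Arguments. Unset Strict Implicit. Unset Printing Implicit Defensive.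
Import Order.TTheory GRing.Theory Num.Theory.
Import numFieldNormedType.Exports.
Local Open Scope classical_set_scope.
Local Open Scope ring_scope.

(** Let [rho_l] be the [L^1]-normalised rescalings of a smooth radial bump [rho], chosen so that
    [d/dl rho_l] is [l] times the Laplacian of a rescaled test function.  For a germ [U] put
    [u := U_x] and average it against [rho_l] around a point [p] with [|p - x| <= 1].  Splitting
    [u = U_p + P + remainder] with [P] affine, the kernel [d/dl rho_l] is even with mean zero and
    annihilates [P], so [[Delta U]] and [[U]] control the variation of the average between a small
    scale [e] and a large scale [r].  At scale [e] the average is [u p] up to [N e^eta] and a
    multiple of [[U]], where [N] is the norm of [U]; at scale [r] its second difference along
    [x, (x + p)/2, p] is at most [N r^(eta - 2)].  Hence [|u p - 2 u ((x + p)/2)|] is at most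
    [sigma N + C ([Delta U] + [U])] with [sigma] as small as desired.  Since [2 * 2^-eta < 1], the
    term [2 u ((x + p)/2)] is a contraction of [N]; rescaling and iterating removes [N].  Real and
    imaginary parts are treated separately. *)

(** * One-dimensional integrals *)

Section integral1.
Variable R : realType.
Local Notation mu := (@lebesgue_measure R).

(** The Laplacian of [U_p] is controlled only in averages centred at the base point [p], which
    forces a new splitting at every centre. Second differences are dictated by 1 < eta < 2: a first
    difference of averages at scale r costs N r^(eta - 1), which grows with r, while a second
    difference decays because eta < 2. The price is the midpoint term, and its factor is below 1
    because eta > 1. The scales e and r depend only on d, alpha and eta, so everything lost between
    them goes into C. Finiteness of N enters only qualitatively: N is multiplied by the k-th power
    of the contraction factor, and k tends to infinity. The polynomial enters only through P(p + y)
    + P(p - y) = 2 P(p).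

    The analysis is kept elementary. All integrands are continuous with compact support, so
    linearity, a sup bound and affine substitution are the main rules needed for the iterated
    integral. Differentiation in the scale rests on a uniform second-order Taylor bound, and the
    Laplacian of the test function is computed pointwise, so there is neither integration by parts
    nor exchange of integrals. *)

Definition csupp1 (M : R) (f : R -> R) :=
  continuous f /\ forall t, M < `|t| -> f t = 0.

Lemma Rintegral_support (f : R -> R) (l r : R) :
  (forall t, ~~ (l <= t <= r) -> f t = 0) ->
  Rintegral mu setT f = Rintegral mu `[l, r] f.
Proof.
move=> f0; rewrite [RHS]Rintegral_mkcond; apply: eq_Rintegral => t _.
rewrite patchE; case: ifPn => // tlr; apply: f0.
by apply: contra tlr => tlr; rewrite inE /= in_itv.
Qed.

Lemma csupp1_out (M : R) f t : csupp1 M f -> ~~ (- M <= t <= M) -> f t = 0.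
Proof. by move=> [_ f0] tM; apply: f0; rewrite ltNge ler_norml. Qed.

Lemma csupp1_integrable (M : R) f : csupp1 M f -> mu.-integrable setT (EFin \o f).
Proof.
move=> cf.
have i1 : mu.-integrable `[(- M), M] (EFin \o f).
  apply: continuous_compact_integrable; first exact: segment_compact.
  by apply: continuous_subspaceT; apply: cf.1.
have := i1; rewrite integrable_mkcond //.
apply: eq_integrable => // t _; rewrite patchE; case: ifPn => // tM.
rewrite /= (csupp1_out cf) //; apply: contra tM => tM.
by rewrite inE /= in_itv.
Qed.

Lemma int1_lin (M : R) a f g : csupp1 M f -> csupp1 M g ->
  Rintegral mu setT (fun t => a * f t + g t) =
  a * Rintegral mu setT f + Rintegral mu setT g.
Proof.
move=> cf cg; have fi := csupp1_integrable cf; have gi := csupp1_integrable cg.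
rewrite RintegralD ?RintegralZl //.
rewrite (_ : _ \o _ = (fun x => a%:E * (EFin \o f) x)%E); last first.
  by apply/funext => x /=; rewrite EFinM.
by apply: integrableZl.
Qed.

Lemma int1_bound (M S : R) f : 0 <= M -> csupp1 M f -> (forall t, `|f t| <= S) ->
  `|Rintegral mu setT f| <= 2 * M * S.
Proof.
move=> M0 cf fS.
rewrite (Rintegral_support (l := - M) (r := M)); last by move=> t; exact: csupp1_out.
have fi : mu.-integrable `[(- M), M] (EFin \o f).
  by apply: integrableS (csupp1_integrable cf).
apply: le_trans (le_normr_Rintegral _ fi) _ => //.
apply: (@le_trans _ _ (Rintegral mu `[(- M), M] (fun=> S))).
  apply: le_Rintegral => //; first exact: integrable_norm.
  apply: continuous_compact_integrable; first exact: segment_compact.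
  by apply: continuous_subspaceT; apply: cst_continuous.
rewrite Rintegral_cst //= lebesgue_measure_itv /=.
case: ifPn => _ /=; last by rewrite mulr0 mulr_ge0 ?mulr_ge0 // (le_trans _ (fS 0)).
by rewrite opprK mulrC [2 * M]mulr_natl mulr2n.
Qed.

Lemma int1_ge (D C : R) f M : 0 < D -> 0 <= C -> csupp1 M f -> (forall t, 0 <= f t) ->
  (forall t, `|t| <= D -> C <= f t) -> 2 * D * C <= Rintegral mu setT f.
Proof.
move=> D0 C0 cf f0 fC.
apply: (@le_trans _ _ (Rintegral mu `[(- D), D] (fun=> C))).
  rewrite Rintegral_cst //= lebesgue_measure_itv /= ifT /=; last first.
    by rewrite lte_fin gtrN.
  by rewrite opprK mulrC [2 * D]mulr_natl mulr2n.
have ic : mu.-integrable `[(- D), D] (EFin \o (fun=> C)).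
  apply: continuous_compact_integrable; first exact: segment_compact.
  by apply: continuous_subspaceT; apply: cst_continuous.
rewrite Rintegral_mkcond; apply: le_Rintegral => //.
- by rewrite -restrict_EFin -integrable_mkcond.
- exact: csupp1_integrable cf.
- move=> t _; rewrite patchE; case: ifPn => // tD; apply: fC.
  by move: tD; rewrite inE /= in_itv /= ler_norml.
Qed.

Lemma int1_affine_pos (M a p : R) f : 0 <= M -> csupp1 M f -> 0 < a ->
  Rintegral mu setT (fun t => f (a * t + p)) = a^-1 * Rintegral mu setT f.
Proof.
move=> M0 cf a0.
pose F : R -> R := fun t => a * t + p.
have dF (x : R) : is_derive x 1 F a.
  rewrite /F.
  have h : is_derive x 1 (fun t : R => a * t + p) (a *: 1 + 0).
    exact: is_deriveD.
  by apply: is_derive_eq h _; rewrite addr0 [LHS]mulr1.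
have DF : F^`()%classic = cst a :> (R -> R).
  by apply/funext => x; rewrite derive1E derive_val.
have cF : continuous F.
  move=> x; apply: cvgD; last exact: cvg_cst.
  by apply: cvgM; [exact: cvg_cst | exact: cvg_id].
(* [F] maps [[l, r]] increasingly onto [[-M, M]], which carries the whole integral of [f]. *)
pose l := (- M - p) / a; pose r := (M - p) / a.
have Fl : F l = - M by rewrite /F /l mulrC divfK ?gt_eqF // subrK.
have Fr : F r = M by rewrite /F /r mulrC divfK ?gt_eqF // subrK.
have lr : l <= r by rewrite ler_pM2r ?invr_gt0 // lerB // lerNl (le_trans _ M0) // oppr_le0.
have := @integration_by_substitution_increasing R F f l r lr.
rewrite Fl Fr DF => sub.
have e : (Rintegral mu `[(- M), M] f =
    Rintegral mu `[l, r] (fun t => f (F t) * a)).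
  rewrite /Rintegral sub //.
  - by move=> x y _ _ xy; rewrite /F ltrD2r ltr_pM2l.
  - by move=> x _; exact: cst_continuous.
  - exact: is_cvg_cst.
  - exact: is_cvg_cst.
  - split.
    + by move=> x _.
    + apply: cvg_at_right_filter; exact: cF.
    + apply: cvg_at_left_filter; exact: cF.
  - apply: continuous_subspaceT; exact: cf.1.
rewrite (Rintegral_support (l := l) (r := r)); last first.
  move=> t tlr; apply: (csupp1_out cf); apply: contra tlr.
  by rewrite /l /r ler_pdivrMr // ler_pdivlMr // lerBlDr lerBrDr mulrC.
rewrite [in RHS](Rintegral_support (l := - M) (r := M)); last by move=> t; exact: csupp1_out.
rewrite e RintegralZr //; first by rewrite mulrC mulfK // gt_eqF.
apply: continuous_compact_integrable; first exact: segment_compact.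
apply: continuous_subspaceT => x.
by apply: continuous_comp; [exact: cF | exact: cf.1].
Qed.

Lemma int1_opp (M : R) f : 0 <= M -> csupp1 M f ->
  Rintegral mu setT (fun t => f (- t)) = Rintegral mu setT f.
Proof.
move=> M0 cf.
have MM : - M <= M by rewrite (le_trans _ M0) // oppr_le0.
have := @integration_by_substitution_oppr R f (- M) M MM.
rewrite opprK => sub.
rewrite (Rintegral_support (l := - M) (r := M)); last first.
  move=> t tM; apply: (csupp1_out cf); apply: contra tM.
  by rewrite lerNr lerNl opprK andbC.
rewrite [RHS](Rintegral_support (l := - M) (r := M)); last by move=> t; exact: csupp1_out.
by rewrite /Rintegral sub //; apply: continuous_subspaceT; exact: cf.1.
Qed.

Lemma int1_affine (M a p : R) f : 0 <= M -> csupp1 M f -> a != 0 ->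
  Rintegral mu setT (fun t => f (a * t + p)) = `|a|^-1 * Rintegral mu setT f.
Proof.
move=> M0 cf; rewrite neq_lt => /orP[a0|a0]; last first.
  by rewrite gtr0_norm //; exact: int1_affine_pos cf a0.
rewrite ltr0_norm //.
have cg : csupp1 M (fun t => f (- t)).
  split; last by move=> t tM; apply: cf.2; rewrite normrN.
  by move=> x; apply: continuous_comp; [exact: opp_continuous | exact: cf.1].
rewrite -[in RHS](int1_opp M0 cf).
rewrite -(int1_affine_pos (- p) M0 cg) ?oppr_gt0 //.
by congr (Rintegral _ _ _); apply/funext => t; congr f; ring.
Qed.

End integral1.

(** * The iterated integral of compactly supported functions *)

Section integral_d.
Variable R : realType.
Local Notation mu := (@lebesgue_measure R).

Definition csupp_in d (M : R) (f : 'rV[R]_d -> R) :=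
  continuous f /\ forall (y : 'rV[R]_d) (i : 'I_d), M < `|y 0 i| -> f y = 0.

Lemma continuous_normP (V W : normedModType R) (f : V -> W) :
  continuous f <-> forall x (e : R), 0 < e ->
    exists2 r : R, 0 < r & forall y, `|x - y| < r -> `|f x - f y| < e.
Proof.
split => [cf x e e0|h x].
  have /cvgrPdist_lt /(_ e e0) /nbhs_ballP [r /= r0 rx] := cf x.
  by exists r => // y xy; apply: rx; rewrite -ball_normE.
apply/cvgrPdist_lt => e e0; have [r r0 rx] := h x e e0.
apply/nbhs_ballP; exists r => //= y; rewrite -ball_normE; exact: rx.
Qed.

Lemma contD (V W : normedModType R) (f g : V -> W) :
  continuous f -> continuous g -> continuous (fun y => f y + g y).
Proof. by move=> cf cg x; exact: cvgD (cf x) (cg x). Qed.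

Lemma contM (V : normedModType R) (f g : V -> R) :
  continuous f -> continuous g -> continuous (fun y => f y * g y).
Proof. by move=> cf cg x; exact: cvgM (cf x) (cg x). Qed.

Lemma contcst (V W : normedModType R) (a : W) : continuous (fun _ : V => a).
Proof. by move=> x; exact: cvg_cst. Qed.

Lemma cont_comp (V W X : normedModType R) (g : V -> W) (f : W -> X) :
  continuous g -> continuous f -> continuous (fun y => f (g y)).
Proof. by move=> cg cf x; apply: continuous_comp; [exact: cg|exact: cf]. Qed.

Lemma rv_norm_le d (x : 'rV[R]_d) (e : R) : 0 <= e ->
  (forall i, `|x 0 i| <= e) -> `|x| <= e.
Proof.
move=> e0 xe; rewrite /Num.norm /= mx_normrE; apply/bigmax_leP; split => //= ij _.
by rewrite (ord1 ij.1).
Qed.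

Lemma coord_norm_le d (x : 'rV[R]_d) i : `|x 0 i| <= `|x|.
Proof.
rewrite [leRHS]/Num.norm /= mx_normrE; apply/bigmax_geP; right.
by exists (0, i).
Qed.

Definition rvcons d (t : R) (y : 'rV[R]_d) : 'rV[R]_d.+1 :=
  row_mx (t%:M : 'rV[R]_1) y.

Lemma rvcons0 d t (y : 'rV[R]_d) : rvcons t y 0 ord0 = t.
Proof.
rewrite /rvcons (_ : ord0 = lshift d (0 : 'I_1)); last exact: val_inj.
by have := row_mxEl (t%:M : 'rV[R]_1) y 0 0; rewrite [X in _ = X -> _]mxE mulr1n.
Qed.

Lemma rvconsS d t (y : 'rV[R]_d) i : rvcons t y 0 (lift ord0 i) = y 0 i.
Proof.
rewrite /rvcons (_ : lift ord0 i = rshift 1 i); last exact: val_inj.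
by have := row_mxEr (t%:M : 'rV[R]_1) y 0 i.
Qed.

Lemma rvcons_eta d (x : 'rV[R]_d.+1) :
  x = rvcons (x 0 ord0) (\row_i x 0 (lift ord0 i)).
Proof.
apply/rowP => i; case: (unliftP ord0 i) => [j|] ->.
  by rewrite rvconsS mxE.
by rewrite rvcons0.
Qed.

Lemma rvcons_dist d t t' (y y' : 'rV[R]_d) (e : R) : `|t - t'| <= e -> `|y - y'| <= e ->
  `|rvcons t y - rvcons t' y'| <= e.
Proof.
move=> te ye; apply: rv_norm_le => [|i]; first exact: le_trans te.
rewrite mxE [X in _ + X]mxE; case: (unliftP ord0 i) => [j|] ->.
  rewrite !rvconsS; apply: le_trans ye.
  by have := coord_norm_le (y - y') j; rewrite !mxE.
by rewrite !rvcons0.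
Qed.

Lemma csupp_in_mono d (M M' : R) (f : 'rV[R]_d -> R) : M <= M' -> csupp_in M f -> csupp_in M' f.
Proof.
by move=> MM [cf f0]; split => // y i My; apply: (f0 y i); apply: le_lt_trans MM My.
Qed.

Lemma csupp_in_slice d M (f : 'rV[R]_d.+1 -> R) t : csupp_in M f ->
  csupp_in M (fun y => f (rvcons t y)).
Proof.
move=> [cf f0]; split => [y|y i My]; last by apply: (f0 _ (lift ord0 i)); rewrite rvconsS.
move: y; apply: (cont_comp (g := rvcons t) _ cf).
apply/continuous_normP => x e e0; exists (e / 2); first by rewrite divr_gt0.
move=> y xy; apply: (@le_lt_trans _ _ (e / 2)); last by rewrite ltr_pdivrMr // ltr_pMr // ltr1n.
by apply: rvcons_dist (ltW xy); rewrite subrr normr0 ltW // divr_gt0.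
Qed.

Lemma csupp_in_slice0 d M (f : 'rV[R]_d.+1 -> R) t : csupp_in M f -> M < `|t| ->
  forall y, f (rvcons t y) = 0.
Proof. by move=> [_ f0] Mt y; apply: (f0 _ ord0); rewrite rvcons0. Qed.

(** Heine-Cantor on a compact cube containing the support; if neither point lies in the cube, [f]
    vanishes at both. Uniformity is what makes the inner integrals depend continuously on the first
    coordinate. *)
Lemma csupp_in_unif d M (f : 'rV[R]_d -> R) : csupp_in M f -> forall e : R, 0 < e ->
  exists2 D : R, 0 < D & forall x y, `|x - y| < D -> `|f x - f y| < e.
Proof.
move=> [cf f0] e e0.
pose K : set 'rV[R]_d := [set v | forall i, `[- (M + 1), M + 1]%classic (v ord0 i)].
have cK : compact K.
  by apply: (@rV_compact _ _ (fun=> `[- (M + 1), M + 1]%classic)) => _; exact: segment_compact.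
have /compact_near_coveringP ncK := cK.
have := ncK R (0^'+) (fun D x => forall y : 'rV[R]_d, `|x - y| < D -> `|f x - f y| < e) _.
move=> /(_ _) nK'.
have nK : \forall D \near 0^'+, K `<=` (fun x => forall y : 'rV[R]_d, `|x - y| < D -> `|f x - f y| < e).
  apply: nK' => x _.
have [|r r0 rx] := (continuous_normP f).1 cf x (e / 2); first by rewrite divr_gt0.
  exists (ball x (r / 2), [set D : R | D < r / 2]).
    split => /=; first by apply: (@nbhsx_ballx _ ('rV[R]_d : normedModType R)); rewrite divr_gt0.
    by apply: nbhs_right_lt; rewrite divr_gt0.
  move=> [x' D] /= [xx' Dr] y x'y.
  have {}xx' : `|x - x'| < r / 2 by move: xx'; rewrite -ball_normE.
  have h1 : `|f x - f x'| < e / 2.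
    by apply: rx; apply: lt_trans xx' _; rewrite ltr_pdivrMr // ltr_pMr // ltr1n.
  have h2 : `|f x - f y| < e / 2.
    apply: rx.
    have -> : x - y = (x - x') + (x' - y) by rewrite addrA subrK.
    by rewrite (le_lt_trans (ler_normD _ _)) // (splitr r) ltrD // (lt_trans x'y).
  have -> : f x' - f y = - (f x - f x') + (f x - f y) by ring.
  by rewrite (le_lt_trans (ler_normD _ _)) // normrN (splitr e) ltrD.
have : \forall D \near 0^'+, [/\ 0 < D, D < 1 & K `<=` (fun x => forall y : 'rV[R]_d, `|x - y| < D -> `|f x - f y| < e)].
  near=> D; split; near: D => //; first exact: nbhs_right_gt.
  exact: nbhs_right_lt.
move=> /filter_ex[D [D0 _ KD]]; exists D => // x y xy.
have [xK|xK] := pselect (K x); first exact: KD.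
have [yK|yK] := pselect (K y).
  by rewrite distrC; apply: KD => //; rewrite distrC.
have out z : ~ K z -> f z = 0.
  move=> zK; have [i zi] : exists i, M < `|z 0 i|.
    apply: contrapT => h; apply: zK => i /=; rewrite in_itv /= -ler_norml.
    rewrite leNgt; apply/negP => h'; apply: h; exists i; apply: lt_trans h'.
    by rewrite ltrDl.
  exact: f0 zi.
by rewrite !out // subrr normr0.
Unshelve. all: by end_near. Qed.

Lemma csupp_in_lin d M (f g : 'rV[R]_d -> R) a : csupp_in M f -> csupp_in M g ->
  csupp_in M (fun y => a * f y + g y).
Proof.
move=> [cf f0] [cg g0]; split => [y|y i My]; last by rewrite (f0 y i) // (g0 y i) // mulr0 addr0.
by move: y; apply: contD cg; apply: contM cf; exact: contcst.
Qed.

(** The three facts depend on each other. Linearity and the bound in dimension d + 1 need the inner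
    integral to be continuous with compact support in the outer variable. That continuity comes from
    the bound in dimension d applied to the difference of two slices, which linearity writes as one
    integral. *)
Lemma intRd_lin_bound d M : 0 <= M ->
  (forall a (f g : 'rV[R]_d -> R), csupp_in M f -> csupp_in M g ->
    intRd (fun y => a * f y + g y) = a * intRd f + intRd g) /\
  (forall S (f : 'rV[R]_d -> R), csupp_in M f -> (forall y, `|f y| <= S) ->
    `|intRd f| <= (2 * M) ^+ d * S) /\
  (forall f : 'rV[R]_d.+1 -> R, csupp_in M f -> csupp1 M (fun t => intRd (fun y => f (rvcons t y)))).
Proof.
move=> M0.
have step n : (forall a (f g : 'rV[R]_n -> R), csupp_in M f -> csupp_in M g ->
    intRd (fun y => a * f y + g y) = a * intRd f + intRd g) ->
  (forall S (f : 'rV[R]_n -> R), csupp_in M f -> (forall y, `|f y| <= S) ->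
    `|intRd f| <= (2 * M) ^+ n * S) ->
  (forall f : 'rV[R]_n.+1 -> R, csupp_in M f -> csupp1 M (fun t => intRd (fun y => f (rvcons t y)))).
  move=> lin bnd f cf; split; last first.
    move=> t Mt; apply/eqP; rewrite -normr_le0.
    have := bnd 0 _ (csupp_in_slice t cf); rewrite mulr0; apply => y.
    by rewrite (csupp_in_slice0 cf Mt) normr0.
  move=> t; apply/cvgrPdist_le => /= e e0.
  (* Chosen so that [(2 * M) ^+ n * e' <= e]; the added 1 keeps the denominator positive when
     [M = 0]. *)
  pose e' := e / ((2 * M) ^+ n + 1).
  have P0 : 0 <= (2 * M) ^+ n by rewrite exprn_ge0 // mulr_ge0.
  have e'0 : 0 < e' by rewrite divr_gt0 // ltr_wpDl.
  have [D D0 fD] := csupp_in_unif cf e'0.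
  near=> s.
  have st : `|s - t| < D.
    by rewrite distrC; near: s; move/cvgrPdist_lt : (@cvg_id _ (nbhs t)); apply.
  have -> : intRd (fun y => f (rvcons t y)) - intRd (fun y => f (rvcons s y)) =
     intRd (fun y => -1 * f (rvcons s y) + f (rvcons t y)).
    by rewrite lin ?mulN1r 1?addrC //; exact: csupp_in_slice.
  apply: (@le_trans _ _ ((2 * M) ^+ n * e')).
    apply: bnd; first by apply: csupp_in_lin; exact: csupp_in_slice.
    move=> y; rewrite mulN1r addrC; apply/ltW/fD.
    apply: le_lt_trans st; rewrite distrC; apply: rvcons_dist => //.
    by rewrite subrr normr0.
  rewrite /e' mulrCA ler_piMr ?(ltW e0) // ler_pdivrMr ?ltr_wpDl // mul1r.
  by rewrite lerDl.
suff [lin bnd] : (forall a (f g : 'rV[R]_d -> R), csupp_in M f -> csupp_in M g ->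
    intRd (fun y => a * f y + g y) = a * intRd f + intRd g) /\
  (forall S (f : 'rV[R]_d -> R), csupp_in M f -> (forall y, `|f y| <= S) ->
    `|intRd f| <= (2 * M) ^+ d * S) by split => //; split => //; exact: step.
elim: d => [|d [lin bnd]].
  by split => [//|S f _ fS]; rewrite expr0 mul1r; exact: fS.
have {}step := step _ lin bnd.
split => [a f g cf cg|S f cf fS].
  rewrite /=; transitivity (Rintegral mu setT (fun t => a * intRd (fun y => f (rvcons t y)) +
     intRd (fun y => g (rvcons t y)))).
    by congr (Rintegral _ _ _); apply/funext => t; rewrite -lin //; exact: csupp_in_slice.
  by rewrite (int1_lin _ (step _ cf) (step _ cg)).
rewrite exprS -mulrA; apply: (int1_bound M0 (step _ cf)) => t.
by apply: bnd; [exact: csupp_in_slice | move=> y; exact: fS].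
Unshelve. all: by end_near. Qed.

Definition csupp d (f : 'rV[R]_d -> R) := exists2 M, 0 <= M & csupp_in M f.

Lemma csupp_common d (f g : 'rV[R]_d -> R) : csupp f -> csupp g ->
  exists M, [/\ 0 <= M, csupp_in M f & csupp_in M g].
Proof.
move=> [M M0 cf] [N N0 cg]; exists (Num.max M N); split.
- by rewrite le_max M0.
- by apply: csupp_in_mono cf; rewrite le_max lexx.
- by apply: csupp_in_mono cg; rewrite le_max lexx orbT.
Qed.

Lemma csupp_lin d (f g : 'rV[R]_d -> R) a : csupp f -> csupp g ->
  csupp (fun y => a * f y + g y).
Proof. by move=> cf /(csupp_common cf)[M [M0 ? ?]]; exists M => //; exact: csupp_in_lin. Qed.

Lemma intRd_lin d (f g : 'rV[R]_d -> R) a : csupp f -> csupp g ->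
  intRd (fun y => a * f y + g y) = a * intRd f + intRd g.
Proof. by move=> cf /(csupp_common cf)[M [M0 ? ?]]; exact: (intRd_lin_bound d M0).1. Qed.

Lemma intRd_bound d M S (f : 'rV[R]_d -> R) : 0 <= M -> csupp_in M f ->
  (forall y, `|f y| <= S) -> `|intRd f| <= (2 * M) ^+ d * S.
Proof. by move=> M0; exact: (intRd_lin_bound d M0).2.1. Qed.

Lemma intRd_csupp1 d M (f : 'rV[R]_d.+1 -> R) : 0 <= M -> csupp_in M f ->
  csupp1 M (fun t => intRd (fun y => f (rvcons t y))).
Proof. by move=> M0; exact: (intRd_lin_bound d M0).2.2. Qed.

Lemma intRd_affine d (f : 'rV[R]_d -> R) a p : csupp f -> a != 0 ->
  intRd (fun y => f (a *: y + p)) = `|a| ^- d * intRd f.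
Proof.
move=> + a0; elim: d f p => [f p _|d IH f p [M M0 cf]].
  by rewrite /= expr0 invr1 mul1r; congr f; apply/rowP => -[].
rewrite [p]rvcons_eta; set p0 := p 0 ord0; set p' := \row_i _.
have sp t y : a *: rvcons t y + rvcons p0 p' = rvcons (a * t + p0) (a *: y + p').
  apply/rowP => i; rewrite mxE [X in X + _]mxE.
  by case: (unliftP ord0 i) => [j|] ->; rewrite ?rvconsS ?rvcons0 // [RHS]mxE [X in _ = X + _]mxE.
rewrite /=; transitivity (Rintegral mu setT (fun t => `|a| ^- d *
     (fun s => intRd (fun y => f (rvcons s y))) (a * t + p0))).
  congr (Rintegral _ _ _); apply/funext => t; rewrite -(IH _ p'); last first.
    by exists M => //; exact: csupp_in_slice.
  by congr intRd; apply/funext => y; rewrite -sp.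
have c1 := intRd_csupp1 M0 cf.
have c2 : csupp1 ((M + `|p0|) / `|a|) (fun t => intRd (fun y => f (rvcons (a * t + p0) y))).
  split => [t|t].
    apply: (@continuous_comp _ _ _ (fun t => a * t + p0) (fun s => intRd (fun y => f (rvcons s y)))).
      apply: cvgD; last exact: cvg_cst.
      by apply: cvgM; [exact: cvg_cst | exact: cvg_id].
    exact: c1.1.
  rewrite ltr_pdivrMr ?normr_gt0 // => Mt; apply: c1.2.
  rewrite -normrM in Mt; have := ler_normB (a * t + p0) p0.
  by rewrite addrK [t * a]mulrC in Mt *; lra.
rewrite RintegralZl //; last exact: csupp1_integrable c2.
by rewrite (int1_affine _ M0 c1 a0) exprS invfM mulrCA mulrA.
Qed.

Lemma intRd_ge0 d (f : 'rV[R]_d -> R) : (forall y, 0 <= f y) -> 0 <= intRd f.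
Proof.
elim: d f => [f f0|d IH f f0] /=; first exact: f0.
by apply: Rintegral_ge0 => t _; apply: IH.
Qed.

(** Serves the strict positivity of the mass of [prof], by which the final estimate is divided. *)
Lemma intRd_ge d D C (f : 'rV[R]_d -> R) : 0 < D -> 0 <= C -> csupp f ->
  (forall y, 0 <= f y) -> (forall y : 'rV[R]_d, (forall i, `|y 0 i| <= D) -> C <= f y) ->
  (2 * D) ^+ d * C <= intRd f.
Proof.
move=> D0 C0; elim: d f => [f _ f0 fC|d IH f [M M0 cf] f0 fC].
  by rewrite expr0 mul1r; apply: fC => -[].
rewrite exprS -mulrA /=; apply: (int1_ge _ _ (intRd_csupp1 M0 cf)) => //.
- by rewrite mulr_ge0 // exprn_ge0 // mulr_ge0 // ltW.
- by move=> t; apply: intRd_ge0.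
- move=> t tD; apply: IH; first by exists M => //; exact: csupp_in_slice.
    by move=> y.
  move=> y yD; apply: fC => i; case: (unliftP ord0 i) => [j|] ->.
    by rewrite rvconsS.
  by rewrite rvcons0.
Qed.

End integral_d.

(** * Smooth bumps of the squared norm *)

Section bump.
Variable R : realType.
Implicit Types (P : {poly R}) (t s : R).
Local Notation is_d f x l := (is_derive (x : R) (1 : R) (f : R -> R) (l : R)).

(** The functions P(1/t) exp(-1/t), extended by 0, are stable under differentiation, so all their
    derivatives are explicit; [P = 1] gives the classical flat function. *)
Definition bump P t : R := if 0 < t then P.[t^-1] * expR (- t^-1) else 0.

Lemma bump_le0 P t : t <= 0 -> bump P t = 0.
Proof. by rewrite /bump ltNge => ->. Qed.

Lemma exprM_expRN_le n (y : R) : 0 <= y -> y ^+ n * expR (- y) <= n`!%:R.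
Proof.
move=> y0; case: n => [|n].
  by rewrite expr0 mul1r fact0 -expR0 ler_expR oppr_le0.
rewrite expRN ler_pdivrMr ?expR_gt0 //.
have n0 : 0 < (n.+1`!%:R : R) by rewrite ltr0n fact_gt0.
rewrite -ler_pdivrMl // mulrC; apply: le_trans (expR_ge1Dxn n y0).
by rewrite lerDr.
Qed.

(** With s = 1/t, each monomial satisfies s^(i+2) exp(-s) <= (i+2)!, which leaves a factor t^2. The
    quadratic order at 0 yields the zero derivative there. *)
Lemma bump_bound P : exists2 C, 0 <= C & forall t, `|bump P t| <= C * t ^+ 2.
Proof.
exists (\sum_(i < size P) `|P`_i| * (i.+2)`!%:R).
  by apply: sumr_ge0 => i _; rewrite mulr_ge0 // ler0n.
move=> t; rewrite /bump; case: ifPn => [t0|_]; last first.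
  by rewrite normr0 mulr_ge0 ?sqr_ge0 //; apply: sumr_ge0 => i _; rewrite mulr_ge0 // ler0n.
rewrite horner_coef mulr_suml mulr_suml; apply: le_trans (ler_norm_sum _ _ _) _.
apply: ler_sum => i _; rewrite !normrM -!mulrA ler_wpM2l //.
rewrite (ger0_norm (expR_ge0 _)) normrX (gtr0_norm (_ : 0 < t^-1)) ?invr_gt0 //.
have -> : t^-1 ^+ i * expR (- t^-1) = (t^-1 ^+ i.+2 * expR (- t^-1)) * t ^+ 2.
  by rewrite !exprS; field; rewrite gt_eqF.
by rewrite ler_wpM2r ?sqr_ge0 // exprM_expRN_le // invr_ge0 ltW.
Qed.

(** In the variable s = 1/t one has d/dt = - s^2 d/ds, which sends P(s) exp(-s) to s^2 (P - P')(s)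
    exp(-s). *)
Definition dbump P := 'X^2 * (P - P^`()).

(** A quadratic error in [h] identifies the derivative. The criterion handles the flat point of
    [bump], squared norms along lines, and integrals depending on a scale. *)
Lemma is_derive_quad (f : R -> R) (x l C r : R) : 0 < r ->
  (forall h, `|h| <= r -> `|f (h + x) - f x - h * l| <= C * h ^+ 2) ->
  is_derive x 1 f l.
Proof.
move=> r0 fC.
have lim : (fun h : R => h^-1 *: ((f \o shift x) (h *: 1) - f x)) @ 0^' --> l.
  apply/cvgrPdist_lt => e e0; near=> h.
  have h0 : h != 0 by near: h; exact: nbhs_dnbhs_neq.
  have hr : `|h| < r.
    near: h; apply: dnbhs0_lt => //.
  have he : `|h| < e / (`|C| + 1).
    near: h; apply: dnbhs0_lt; rewrite divr_gt0 // ltr_wpDl //.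
  have := fC h (ltW hr); rewrite /= [h *: 1]mulr1 => fh.
  rewrite distrC (_ : _ - l = h^-1 * (f (h + x) - f x - h * l)); last first.
    by rewrite /GRing.scale /=; field.
  rewrite normrM normfV mulrC ltr_pdivrMr ?normr_gt0 //.
  apply: le_lt_trans fh _.
  rewrite -real_normK ?num_real // expr2 mulrA ltr_pM2r ?normr_gt0 //.
  apply: (@le_lt_trans _ _ ((`|C| + 1) * `|h|)).
    by rewrite ler_wpM2r // (le_trans (ler_norm _)) // lerDl.
  by rewrite mulrC -ltr_pdivlMr // ltr_wpDl.
apply: DeriveDef; first by apply/cvg_ex; exists l.
exact: cvg_lim lim.
Unshelve. all: by end_near. Qed.

Lemma is_derive_bump P t : is_derive t 1 (bump P) (bump (dbump P) t).
Proof.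
have [t0|t0|t0] := ltrgtP t 0.
- rewrite [bump (dbump P) t]bump_le0 ?ltW //.
  apply: (@near_eq_is_derive _ _ _ (fun=> 0 : R)).
  by near=> s; rewrite bump_le0 // ltW //; near: s; exact: lt_nbhsl.
- have tn : t != 0 by rewrite gt_eqF.
  apply: (@near_eq_is_derive _ _ _ (fun s => P.[s^-1] * expR (- s^-1))).
    by near=> s; rewrite /bump ifT //; near: s; exact: lt_nbhsr.
  have dV : is_derive t 1 (fun s : R => s^-1) (- t ^- 2).
    have := @is_deriveV R (@id R) t 1 1 tn (is_derive_id _ _).
    by move=> h; apply: is_derive_eq h _; rewrite [LHS]mulr1.
  have dp : is_derive (t^-1) 1 (horner P) (P^`().[t^-1]).
    apply: DeriveDef; first exact: derivable_horner.
    by rewrite -derive1E -derivE.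
  have d1 : is_derive t 1 (fun s => P.[s^-1]) (P^`().[t^-1] * - t ^- 2).
    exact: (@is_derive1_comp _ (horner P) (fun s : R => s^-1)).
  have d2 : is_derive t 1 (fun s => expR (- s^-1)) (expR (- t^-1) * t ^- 2).
    have h := @is_derive1_comp _ (@expR R) (fun s : R => - s^-1) t (expR (- t^-1)) (t ^- 2).
    apply: (h (is_derive_expR _)).
    have := is_deriveN dV; rewrite opprK; exact.
  have := is_deriveM d1 d2; move=> h; apply: is_derive_eq h _.
  rewrite /bump t0 /dbump !hornerE /GRing.scale /=; field.
  by rewrite tn.
- subst t; rewrite bump_le0 //.
  have [C C0 bC] := bump_bound P.
  apply: (@is_derive_quad _ _ _ C 1) => // h _.
  by rewrite (bump_le0 _ (lexx 0)) mulr0 !subr0 addr0; exact: bC.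
Unshelve. all: by end_near. Qed.


Lemma is_derive_continuous (f df : R -> R) :
  (forall x, is_d f x (df x)) -> continuous f.
Proof.
move=> fd x; apply: differentiable_continuous; apply/derivable1_diffP.
by have [] := fd x.
Qed.

Lemma MVT_le (w w1 : R -> R) x y : x <= y ->
  (forall z, x <= z <= y -> is_d w z (w1 z)) ->
  exists z, x <= z <= y /\ w y - w x = w1 z * (y - x).
Proof.
move=> xy dw.
have [z zxy e] : exists2 c, c \in `[x, y] & w y - w x = w1 c * (y - x).
  apply: MVT_segment => // [z|].
    by rewrite in_itv /= => /andP[xz zy]; apply: dw; rewrite !ltW.
  apply: derivable_within_continuous => z; rewrite in_itv /= => zxy.
  by have [] := dw z zxy.
by exists z; split => //; move: zxy; rewrite in_itv.
Qed.

(** No order between [x] and [y] is assumed, and the intermediate point is no farther from [x] than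
    [y] is; this permits a second application in [taylor2]. *)
Lemma MVT_between (w w1 : R -> R) a b x y :
  (forall z, a <= z <= b -> is_d w z (w1 z)) ->
  a <= x <= b -> a <= y <= b ->
  exists z, [/\ a <= z <= b, `|z - x| <= `|y - x| & w y - w x = w1 z * (y - x)].
Proof.
move=> dw /andP[ax xb] /andP[ay yb]; have [xy|yx] := leP x y.
  have [z|z [/andP[xz zy] e]] := @MVT_le w w1 x y xy.
    by move=> /andP[xz zy]; apply: dw; rewrite (le_trans ax) // (le_trans zy).
  exists z; split => //; first by rewrite (le_trans ax) // (le_trans zy).
  by rewrite !ger0_norm ?subr_ge0 // lerD2r.
have [z|z [/andP[yz zx] e]] := @MVT_le w w1 y x (ltW yx).
  by move=> /andP[yz zx]; apply: dw; rewrite (le_trans ay) // (le_trans zx).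
exists z; split => //; first by rewrite (le_trans ay) // (le_trans zx).
  by rewrite !ler0_norm ?subr_le0 // ?(ltW yx) // lerN2 lerD2r.
by rewrite -opprB e; ring.
Qed.

(** The mean value theorem used twice; the constant is B instead of B / 2, which suffices. *)
Lemma taylor2 (w w1 w2 : R -> R) a b B x y :
  (forall z, a <= z <= b -> is_d w z (w1 z)) ->
  (forall z, a <= z <= b -> is_d w1 z (w2 z)) ->
  (forall z, a <= z <= b -> `|w2 z| <= B) ->
  a <= x <= b -> a <= y <= b ->
  `|w y - w x - (y - x) * w1 x| <= B * (y - x) ^+ 2.
Proof.
move=> dw dw1 bw xab yab.
have [z [zab zx ->]] := MVT_between dw xab yab.
have [z' [zab' zx' e]] := MVT_between dw1 xab zab.
rewrite (_ : _ - _ = (w1 z - w1 x) * (y - x)); last by ring.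
rewrite e !normrM -[_ ^+ 2]real_normK ?num_real // expr2 mulrA.
by rewrite ler_wpM2r // ler_pM // bw.
Qed.

(** For s = |y|^2 the term 2 s f'(s) is the radial derivative y . grad of f(|y|^2). With n = d the
    bracket is the divergence of y f(|y|^2), taken at y / l; with n = d + 1 the lemma gives the
    second derivative in the scale. *)
Lemma is_derive_profile n (f df : R -> R) s l : l != 0 ->
  (forall x, is_d f x (df x)) ->
  is_d (fun l => l ^- n * f (s / l ^+ 2)) l
    (- (l ^- n.+1 * (n%:R * f (s / l ^+ 2) + 2 * (s / l ^+ 2) * df (s / l ^+ 2)))).
Proof.
move=> l0 fd.
have dX m : is_d (fun l => l ^+ m) l (m%:R * l ^+ m.-1).
  apply: DeriveDef; first exact: exprn_derivable.
  by rewrite exp_derive [LHS]mulr1.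
have dV m : is_d (fun l => l ^- m) l (- l ^- m.*2 * (m%:R * l ^+ m.-1)).
  have := @is_deriveV R (fun l => l ^+ m) l _ 1 (expf_neq0 m l0) (dX m); move=> h; apply: is_derive_eq h _.
  by rewrite -exprM muln2.
have d2 : is_d (fun l => s / l ^+ 2) l (s * (- l ^- 4 * (2%:R * l))).
  have := is_deriveZ s (dV 2); exact.
have df2 := @is_derive1_comp _ f _ l _ _ (fd _) d2.
have := is_deriveM (dV n) df2; move=> h; apply: is_derive_eq h _.
rewrite /GRing.scale /=; case: n => [|n].
  by rewrite expr0 /=; field.
by rewrite -addnn exprD /= !exprS; field; rewrite l0 expf_neq0.
Qed.

(** Boundedness is asked only for [0 <= s], since profiles are evaluated at squared norms. *)
Definition cutoff_bdd (c : R) (f : R -> R) := (forall s, c <= s -> f s = 0) /\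
  exists2 M, 0 <= M & forall s, 0 <= s -> `|f s| <= M.

Lemma cutoff_bdd_lin c a b f g : cutoff_bdd c f -> cutoff_bdd c g -> cutoff_bdd c (fun s => a * f s + b * g s).
Proof.
move=> [f0 [M M0 fM]] [g0 [N N0 gN]]; split.
  by move=> s cs; rewrite f0 // g0 // !mulr0 addr0.
exists (`|a| * M + `|b| * N); first by rewrite addr_ge0 // mulr_ge0.
move=> s s0; apply: le_trans (ler_normD _ _) _.
by rewrite !normrM lerD // ler_wpM2l // ?fM ?gN.
Qed.

Lemma cutoff_bdd_id c f : 0 <= c -> cutoff_bdd c f -> cutoff_bdd c (fun s => s * f s).
Proof.
move=> c0 [f0 [M M0 fM]]; split => [s cs|]; first by rewrite f0 // mulr0.
exists (c * M); first by rewrite mulr_ge0.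
move=> s s0; have [cs|sc] := leP c s; first by rewrite f0 // mulr0 normr0 mulr_ge0.
by rewrite normrM ler_pM // ?fM // ger0_norm // ltW.
Qed.

Definition cbump (c : R) P s := bump P (c - s).

Lemma is_derive_cbump c P s : is_d (cbump c P) s (- cbump c (dbump P) s).
Proof.
have d1 : is_d (fun s => c - s) s (-1).
  have := is_deriveB (is_derive_cst c s 1) (is_derive_id s (1 : R)).
  by move=> h; apply: is_derive_eq h _; rewrite sub0r.
have := @is_derive1_comp _ (bump P) _ s _ _ (is_derive_bump P _) d1.
by move=> h; apply: is_derive_eq h _; rewrite mulrN1.
Qed.

Lemma cbump_cutoff_bdd c P : 0 <= c -> cutoff_bdd c (cbump c P).
Proof.
move=> c0; split => [s cs|]; first by rewrite /cbump bump_le0 // subr_le0.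
have [C C0 bC] := bump_bound P; exists (C * c ^+ 2).
  by rewrite mulr_ge0 // sqr_ge0.
move=> s s0; have [cs|sc] := leP c s.
  by rewrite /cbump bump_le0 ?subr_le0 // normr0 mulr_ge0 // sqr_ge0.
apply: le_trans (bC _) _; rewrite ler_wpM2l // lerXn2r ?nnegrE ?subr_ge0 ?(ltW sc) //.
by rewrite gerBl.
Qed.

End bump.

(** * Radial functions and their partial derivatives *)

Section radial.
Variables (R : realType) (d : nat).
Implicit Types (x y z : 'rV[R]_d).
Local Notation is_d f x l := (is_derive (x : R) (1 : R) (f : R -> R) (l : R)).

Lemma is_derive_dir (f : 'rV[R]_d -> R) x v l :
  is_d (fun h => f (h *: v + x)) 0 l -> is_derive x v f l.
Proof.
move=> [df <-]; apply: DeriveDef; first exact/derivable1P.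
rewrite /derive; set g1 := fun h => h^-1 *: _; set g2 := fun h => h^-1 *: _.
suff -> : g1 = g2 by [].
rewrite funeqE /g1 /g2 => h /=; by rewrite addr0 scale0r add0r [_%:A]mulr1.
Qed.

Definition sq x : R := \sum_i x 0 i ^+ 2.

Lemma sq_ge0 x : 0 <= sq x. Proof. by apply: sumr_ge0 => i _; exact: sqr_ge0. Qed.

Lemma sqZ a x : sq (a *: x) = a ^+ 2 * sq x.
Proof. by rewrite /sq mulr_sumr; apply: eq_bigr => i _; rewrite mxE exprMn. Qed.

Lemma sqN x : sq (- x) = sq x.
Proof. by rewrite -scaleN1r sqZ sqrrN expr1n mul1r. Qed.

Lemma sq_evec a h i x y : sq (a *: (h *: evec R i + x - y)) =
  sq (a *: (x - y)) + (2 * a * (a *: (x - y)) 0 i) * h + a ^+ 2 * h ^+ 2.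
Proof.
have e : a *: (h *: evec R i + x - y) = (a * h) *: evec R i + a *: (x - y).
  by rewrite -addrA scalerDr scalerA.
rewrite e; set z := a *: (x - y); rewrite /sq (bigD1 i) //= [in RHS](bigD1 i) //=.
rewrite (eq_bigr (fun j => z 0 j ^+ 2)); last first.
  by move=> j ji; rewrite !mxE eqxx (negbTE ji) mulr0 add0r.
have -> : ((a * h) *: evec R i + z) 0 i = a * h + z 0 i.
  by rewrite [LHS]mxE [X in X + _]mxE mxE !eqxx mulr1.
by ring.
Qed.

Lemma is_derive_radial (g dg : R -> R) a x y i : (forall s, is_d g s (dg s)) ->
  is_derive x (evec R i) (fun x => g (sq (a *: (x - y))))
    (2 * a * (a *: (x - y)) 0 i * dg (sq (a *: (x - y)))).
Proof.
move=> gd; apply: is_derive_dir.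
set b := 2 * a * _; set s := sq _.
have dq : is_d (fun h => s + b * h + a ^+ 2 * h ^+ 2) 0 b.
  apply: (@is_derive_quad _ _ _ _ (a ^+ 2) 1) => // h _.
  rewrite addr0 !mulr0 expr0n /= mulr0 !addr0 (_ : _ - _ = a ^+ 2 * h ^+ 2); last by ring.
  by rewrite ger0_norm // mulr_ge0 ?sqr_ge0.
have := @is_derive1_comp _ g _ 0 _ _ (gd _) dq.
rewrite !mulr0 expr0n /= mulr0 !addr0 mulrC.
by congr is_derive; apply/funext => h /=; rewrite sq_evec.
Qed.

Lemma is_derive_coord x y a i j : is_derive x (evec R i)
  (fun x => (a *: (x - y)) 0 j) (a * (j == i)%:R).
Proof.
apply: is_derive_dir.
apply: (@is_derive_quad _ _ _ _ 0 1) => // h _.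
by rewrite !mxE eqxx /= !mul0r normr_le0; apply/eqP; ring.
Qed.

(** An algebra of continuous functions closed under partial derivatives, so smoothness of the test
    function follows by induction without computing higher derivatives. *)
Inductive bump_class (c : R) : ('rV[R]_d -> R) -> Prop :=
| bump_class_cst a : bump_class c (fun=> a)
| bump_class_coord i : bump_class c (fun x => x 0 i)
| bump_class_bump P : bump_class c (fun x => cbump c P (sq x))
| bump_class_add f g : bump_class c f -> bump_class c g -> bump_class c (fun x => f x + g x)
| bump_class_mul f g : bump_class c f -> bump_class c g -> bump_class c (fun x => f x * g x).

Lemma bump_class_diff c f : bump_class c f -> forall i,
  exists2 g, bump_class c g & forall x, is_derive x (evec R i) f (g x).
Proof.
elim=> {f} [a|j|P|f1 f2 c1 IH1 c2 IH2|f1 f2 c1 IH1 c2 IH2] i.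
- by exists (fun=> 0); [exact: bump_class_cst | move=> x; exact: is_derive_cst].
- exists (fun=> (j == i)%:R); first exact: bump_class_cst.
  move=> x; have := is_derive_coord x 0 1 i j; rewrite mul1r.
  by congr is_derive; apply/funext => z; rewrite subr0 scale1r.
- exists (fun x => 2 * x 0 i * (-1 * cbump c (dbump P) (sq x))).
    apply: bump_class_mul; first by apply: bump_class_mul; [exact: bump_class_cst|exact: bump_class_coord].
    by apply: bump_class_mul; [exact: bump_class_cst|exact: bump_class_bump].
  move=> x; have := is_derive_radial 1 x 0 i (is_derive_cbump c P).
  rewrite subr0 scale1r mulr1 mulN1r.
  by congr is_derive; apply/funext => z; rewrite subr0 scale1r.
- have [g1 cg1 d1] := IH1 i; have [g2 cg2 d2] := IH2 i.
  exists (fun x => g1 x + g2 x); first exact: bump_class_add.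
  by move=> x; exact: is_deriveD.
- have [g1 cg1 d1] := IH1 i; have [g2 cg2 d2] := IH2 i.
  exists (fun x => f1 x * g2 x + f2 x * g1 x).
    by apply: bump_class_add; exact: bump_class_mul.
  by move=> x; exact: is_deriveM.
Qed.

End radial.

(** * A test function and its Laplacian *)

Section testfun.
Variables (R : realType) (d : nat).
Implicit Types (x y z : 'rV[R]_d).
Local Notation is_d f x l := (is_derive (x : R) (1 : R) (f : R -> R) (l : R)).

Lemma cont_sum (V : normedModType R) (I : Type) (r : seq I) (F : I -> V -> R) :
  (forall i, continuous (F i)) -> continuous (fun v : V => \sum_(i <- r) F i v).
Proof.
move=> cF; elim: r => [|i r IH].
  by rewrite (_ : (fun _ => _) = fun=> 0); [exact: contcst | apply/funext => v; rewrite big_nil].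
rewrite (_ : (fun _ => _) = fun v => F i v + \sum_(i <- r) F i v).
  exact: contD.
by apply/funext => v; rewrite big_cons.
Qed.

Lemma cont_coord i : continuous (fun x => x 0 i).
Proof. exact: coord_continuous. Qed.

Lemma cont_sq : continuous (@sq R d).
Proof.
apply: cont_sum => i; rewrite (_ : (fun _ => _) = fun x => x 0 i * x 0 i).
  by apply: contM; exact: cont_coord.
by apply/funext => x; rewrite expr2.
Qed.

Lemma cont_affine a (p : 'rV[R]_d) : continuous (fun y => a *: y + p).
Proof.
apply: contD; last exact: contcst.
exact: (@scaler_continuous _ 'rV[R]_d).
Qed.

Lemma cont_cbump (c : R) P : continuous (cbump c P).
Proof. exact: is_derive_continuous (is_derive_cbump c P). Qed.

Lemma bump_class_cont c f : @bump_class R d c f -> continuous f.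
Proof.
elim=> {f} [a|j|P|f1 f2 c1 IH1 c2 IH2|f1 f2 c1 IH1 c2 IH2].
- exact: contcst.
- exact: cont_coord.
- exact: cont_comp cont_sq (@cont_cbump _ _).
- exact: contD.
- exact: contM.
Qed.

Lemma smooth_bump_class c f : @bump_class R d c f -> smooth f.
Proof.
move=> cf.
have it s : bump_class c (iter_partial s f).
  elim: s => [//|i s IH] /=.
  have [g cg dg] := bump_class_diff IH i.
  rewrite (_ : partial i _ = g) //; apply/funext => x.
  by rewrite /partial; have [_ ->] := dg x.
split => [s|s i x]; first exact: bump_class_cont (it s).
by have [g cg dg] := bump_class_diff (it s) i; have [] := dg x.
Qed.

(** The value 1 / (2d + 2) serves twice: d coordinates of this size have l^1 norm below 1, so the
    support lies in the unit ball of [dist], and [2 * test_rad <= 1] absorbs the factor 2 from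
    differentiating [sq]. It makes sense for [d = 0] too. *)
Definition test_rad : R := (d.*2.+2)%:R^-1.
Definition test_cut : R := test_rad ^+ 2.

Lemma test_rad_gt0 : 0 < test_rad. Proof. by rewrite invr_gt0 ltr0n. Qed.
Lemma test_rad_le : 2 * test_rad <= 1.
Proof. by rewrite ler_pdivrMr ?ltr0n // mul1r ler_nat. Qed.
Lemma test_cut_gt0 : 0 < test_cut. Proof. by rewrite exprn_gt0 // test_rad_gt0. Qed.

Lemma sq_coord y i : sq y <= test_cut -> `|y 0 i| <= test_rad.
Proof.
move=> yc; rewrite -ler_sqr ?nnegrE ?(ltW test_rad_gt0) // real_normK ?num_real //.
apply: le_trans yc; rewrite /sq (bigD1 i) //= lerDl.
by apply: sumr_ge0 => j _; exact: sqr_ge0.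
Qed.

Lemma dist0E y : dist 0 y = \sum_i `|y 0 i|.
Proof. by apply: eq_bigr => i _; rewrite mxE sub0r normrN. Qed.

Lemma sq_dist y : sq y <= test_cut -> dist 0 y < 1.
Proof.
move=> yc; rewrite dist0E; apply: (@le_lt_trans _ _ (\sum_(i < d) test_rad)).
  by apply: ler_sum => i _; exact: sq_coord.
rewrite sumr_const card_ord -mulr_natl ltr_pdivrMr ?ltr0n // mul1r ltr_nat.
by rewrite -addnn -addnS -addSn leq_addr.
Qed.

Let P1 : {poly R} := dbump 1.

(** With [f := cbump test_cut 1] this is -2 f', so the gradient of f(|x|^2) is - x prof(|x|^2). The
    divergence of x prof(|x|^2), which is what a change of scale produces, is therefore minus the
    Laplacian of a test function. *)
Definition prof s := 2 * cbump test_cut P1 s.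
Definition dprof s := - 2 * cbump test_cut (dbump P1) s.
Definition ddprof s := 2 * cbump test_cut (dbump (dbump P1)) s.
(* If [psi x := cbump test_cut 1 (sq x)], then [lap_prof (sq x)] is minus the Laplacian of
   [psi] at [x], while [lambda^-d * prof (sq x / lambda^2)] has [lambda]-derivative
   [- lambda^-(d+1) * lap_prof (sq x / lambda^2)]. *)
Definition lap_prof s := d%:R * prof s + 2 * s * dprof s.
Definition dlap_prof s := (d%:R + 2) * dprof s + 2 * s * ddprof s.

Lemma is_derive_prof s : is_d prof s (dprof s).
Proof.
have := is_deriveZ 2 (is_derive_cbump test_cut P1 s); move=> h; apply: is_derive_eq h _.
by rewrite /dprof /GRing.scale /= mulrN mulNr.
Qed.

Lemma is_derive_dprof s : is_d dprof s (ddprof s).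
Proof.
have := is_deriveZ (-2) (is_derive_cbump test_cut (dbump P1) s); move=> h; apply: is_derive_eq h _.
by rewrite /ddprof /GRing.scale /= mulrNN.
Qed.

Lemma is_derive_lap_prof s : is_d lap_prof s (dlap_prof s).
Proof.
have h1 := is_deriveZ d%:R (is_derive_prof s).
have h2 := is_deriveZ 2 (is_deriveM (is_derive_id s (1 : R)) (is_derive_dprof s)).
have h := is_deriveD h1 h2.
rewrite (_ : lap_prof = d%:R *: prof + 2 *: (id * dprof)); last first.
  by apply/funext => x; rewrite /lap_prof -mulrA.
apply: is_derive_eq h _.
by rewrite /dlap_prof /GRing.scale /=; ring.
Qed.

Lemma cutoff_bdd_prof : cutoff_bdd test_cut prof.
Proof.
have h := cbump_cutoff_bdd P1 (ltW test_cut_gt0).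
by have := cutoff_bdd_lin 2 0 h h; congr cutoff_bdd; apply/funext => s; rewrite mul0r addr0.
Qed.

Lemma cutoff_bdd_dprof : cutoff_bdd test_cut dprof.
Proof.
have h := cbump_cutoff_bdd (dbump P1) (ltW test_cut_gt0).
by have := cutoff_bdd_lin (- 2) 0 h h; congr cutoff_bdd; apply/funext => s; rewrite mul0r addr0.
Qed.

Lemma cutoff_bdd_ddprof : cutoff_bdd test_cut ddprof.
Proof.
have h := cbump_cutoff_bdd (dbump (dbump P1)) (ltW test_cut_gt0).
by have := cutoff_bdd_lin 2 0 h h; congr cutoff_bdd; apply/funext => s; rewrite mul0r addr0.
Qed.

Lemma cutoff_bdd_lap_prof : cutoff_bdd test_cut lap_prof.
Proof.
have := cutoff_bdd_lin d%:R 2 cutoff_bdd_prof (cutoff_bdd_id (ltW test_cut_gt0) cutoff_bdd_dprof).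
by congr cutoff_bdd; apply/funext => s; rewrite /lap_prof mulrA.
Qed.

Lemma cutoff_bdd_dlap_prof : cutoff_bdd test_cut dlap_prof.
Proof.
have := cutoff_bdd_lin (d%:R + 2) 2 cutoff_bdd_dprof (cutoff_bdd_id (ltW test_cut_gt0) cutoff_bdd_ddprof).
by congr cutoff_bdd; apply/funext => s; rewrite /dlap_prof mulrA.
Qed.

Lemma prof_ge0 s : 0 <= prof s.
Proof.
rewrite mulr_ge0 // /cbump /bump; case: ifP => // _.
rewrite mulr_ge0 ?expR_ge0 // /P1 /dbump !hornerE derivC hornerC subr0 mulr1.
exact: sqr_ge0.
Qed.

Lemma prof_lb : exists2 C : R, 0 < C & forall s, 0 <= s <= test_cut / 2 -> C <= prof s.
Proof.
have c0 := test_cut_gt0.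
exists (2 * (test_cut^-1 ^+ 2 * expR (- (test_cut / 2)^-1))).
  by rewrite mulr_gt0 // mulr_gt0 ?expR_gt0 // exprn_gt0 // invr_gt0.
move=> s /andP[s0 sc]; rewrite /prof ler_pM2l // /cbump /bump.
have t0 : 0 < test_cut - s by lra.
rewrite t0 /P1 /dbump !hornerE derivC hornerC subr0 mulr1.
apply: ler_pM; rewrite ?sqr_ge0 ?expR_ge0 //.
  by rewrite lerXn2r ?nnegrE ?invr_ge0 ?(ltW c0) ?(ltW t0) // lef_pV2 ?posrE //; lra.
by rewrite ler_expR lerN2 lef_pV2 ?posrE //; lra.
Qed.

(** Order 1 is the order of the test functions for the exponent [eta - 2]. The factor 1 / (1 + M +
    N) normalises both the bump, bounded by M, and its first partials, bounded by N because
    [2 * |x_i| <= 1] on the support. *)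
Lemma testB_bump : exists2 k : R, 0 < k &
  testB 1 (fun x => k * cbump test_cut 1 (sq x)).
Proof.
have [_ [M M0 gM]] := cbump_cutoff_bdd 1 (ltW test_cut_gt0).
have [g0 [N N0 gN]] := cbump_cutoff_bdd P1 (ltW test_cut_gt0).
have q0 : 0 < 1 + M + N by rewrite -addrA ltr_pwDl // addr_ge0.
have k0 : 0 < (1 + M + N)^-1 by rewrite invr_gt0.
exists (1 + M + N)^-1 => //.
have kM : (1 + M + N)^-1 * M <= 1 by rewrite mulrC ler_pdivrMr // mul1r; lra.
have kN : (1 + M + N)^-1 * N <= 1 by rewrite mulrC ler_pdivrMr // mul1r; lra.
set k := (_ + _)^-1 in k0 kM kN *; set phi := fun x => _.
have dphi x i : is_derive x (evec R i) phi (k * (2 * x 0 i * - cbump test_cut P1 (sq x))).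
  have := is_deriveZ k (is_derive_radial 1 x 0 i (is_derive_cbump test_cut 1)).
  rewrite subr0 scale1r mulr1.
  by congr is_derive; apply/funext => z; rewrite /phi /= subr0 scale1r.
split; last split.
- by apply: (@smooth_bump_class test_cut); apply: bump_class_mul; [exact: bump_class_cst|exact: bump_class_bump].
(* The closure of the support may reach [sq y = test_cut]; [sq_dist] still gives a strict inequality
   there. *)
- have cl : closed ((@sq R d) @^-1` [set s | s <= test_cut]).
    apply: preimage_closed; last exact: closed_le.
    by move=> y _; exact: cont_sq.
  move=> y yc; rewrite /dball /=; apply: sq_dist.
  apply: cl; apply: closure_subset yc => z /=; apply: contraNT; rewrite -ltNge => zc.
  by rewrite /phi (cbump_cutoff_bdd 1 (ltW test_cut_gt0)).1 ?mulr0 // ltW.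
- move=> b y bs; rewrite /dmulti; set s := flatten _.
  have : (size s <= 1)%N.
    rewrite size_flatten /shape -map_comp sumnE big_map big_enum /=.
    by rewrite (eq_bigr b) // => i _; rewrite size_nseq.
  case: s => [|i [|//]] _ /=.
    by rewrite normrM gtr0_norm // (le_trans _ kM) // ler_wpM2l ?(ltW k0) // gM // sq_ge0.
  rewrite /partial; have [_ ->] := dphi y i.
  rewrite normrM gtr0_norm // (le_trans _ kN) // ler_wpM2l ?(ltW k0) //.
  have [cy|yc] := leP test_cut (sq y); first by rewrite g0 // oppr0 mulr0 normr0.
  rewrite normrM normrN -[N]mul1r ler_pM // ?gN ?sq_ge0 //.
  rewrite normrM gtr0_norm //; apply: le_trans test_rad_le.
  by rewrite ler_wpM2l // sq_coord // ltW.
Qed.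

(** Summing over coordinates turns the terms 2 u_i^2 dprof into 2 s dprof. As [lapGerm] already puts
    the Laplacian on the test function, this pointwise identity is the whole link between it and
    [kern lap_prof]. *)
Lemma laplace_bump k lam x y : 0 < lam ->
  laplace (rescale (fun x => k * cbump test_cut 1 (sq x)) x lam) y =
  - k * lam ^- d.+2 * lap_prof (sq (lam^-1 *: (y - x))).
Proof.
move=> l0; set a := lam^-1.
have d1 z i : is_derive z (evec R i) (rescale (fun x => k * cbump test_cut 1 (sq x)) x lam)
   (lam ^- d * k * (2 * a * (a *: (z - x)) 0 i * - cbump test_cut P1 (sq (a *: (z - x))))).
  have := is_deriveZ (lam ^- d * k) (is_derive_radial a z x i (is_derive_cbump test_cut 1)).
  by congr is_derive; apply/funext => t; rewrite /rescale /= /GRing.scale /= mulrA.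
rewrite /laplace (eq_bigr (fun i => - k * lam ^- d * a ^+ 2 *
  (prof (sq (a *: (y - x))) + 2 * (a *: (y - x)) 0 i ^+ 2 * dprof (sq (a *: (y - x)))))); last first.
  move=> i _; rewrite (_ : partial i (rescale _ _ _) = fun z =>
    (lam ^- d * k * (2 * a * (a *: (z - x)) 0 i * - cbump test_cut P1 (sq (a *: (z - x)))))); last first.
    by apply/funext => z; rewrite /partial; have [_ ->] := d1 z i.
  have h1 := is_derive_coord y x a i i; rewrite eqxx mulr1 in h1.
  have h2 := is_derive_radial a y x i (is_derive_cbump test_cut P1).
  have := is_deriveZ (- (lam ^- d * k * 2 * a)) (is_deriveM h1 h2).
  rewrite /partial => -[_].
  rewrite [X in 'D_(evec R i) X y = _ -> _](_ : _ = fun z => lam ^- d * k *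
     (2 * a * (a *: (z - x)) 0 i * - cbump test_cut P1 (sq (a *: (z - x))))); last first.
    apply/funext => z; change (- (lam ^- d * k * 2 * a) *
      ((a *: (z - x)) 0 i * cbump test_cut P1 (sq (a *: (z - x)))) =
      lam ^- d * k * (2 * a * (a *: (z - x)) 0 i * - cbump test_cut P1 (sq (a *: (z - x))))); ring.
  move=> ->; rewrite /prof /dprof.
  set u := (a *: (y - x)) 0 i; set s := sq _.
  change (- (lam ^- d * k * 2 * a) * (u * (2 * a * u * - cbump test_cut (dbump P1) s) + cbump test_cut P1 s * a) =
    - k * lam ^- d * a ^+ 2 * (2 * cbump test_cut P1 s + 2 * u ^+ 2 * (- 2 * cbump test_cut (dbump P1) s))); ring.
rewrite -mulr_sumr big_split /= sumr_const card_ord -mulr_suml -mulr_sumr -/(sq _).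
rewrite (_ : - k * lam ^- d * a ^+ 2 = - k * lam ^- d.+2).
  by rewrite /lap_prof -(mulr_natl (prof _) d).
by rewrite /a -mulrA -exprVn -exprD -exprVn addn2.
Qed.

End testfun.

(** * Averages against radial kernels *)

Section kernels.
Variables (R : realType) (d : nat).
Implicit Types (x y z p : 'rV[R]_d) (u v : 'rV[R]_d -> R) (g : R -> R).
Local Notation is_d f x l := (is_derive (x : R) (1 : R) (f : R -> R) (l : R)).
Local Notation test_cut := (test_cut R d).
Local Notation test_rad := (test_rad R d).
Local Notation prof := (@prof R d).
Local Notation lap_prof := (@lap_prof R d).

Lemma cont1 : continuous (fun _ : 'rV[R]_d => 1 : R).
Proof. exact: contcst. Qed.

Lemma csupp_zero : csupp (fun _ : 'rV[R]_d => 0 : R).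
Proof. by exists 0 => //; split => //; exact: contcst. Qed.

Lemma intRd0 : intRd (fun _ : 'rV[R]_d => 0 : R) = 0.
Proof.
apply/eqP; rewrite -normr_le0.
have [M M0 cM] := csupp_zero.
have := @intRd_bound R d M 0 _ M0 cM; rewrite mulr0; apply.
by move=> y; rewrite normr0.
Qed.

Lemma intRdZ a (f : 'rV[R]_d -> R) : csupp f -> intRd (fun y => a * f y) = a * intRd f.
Proof.
move=> cf; rewrite -[RHS]addr0 -intRd0 -(intRd_lin _ cf csupp_zero).
by congr intRd; apply/funext => y; rewrite addr0.
Qed.

Lemma intRdD (f h : 'rV[R]_d -> R) : csupp f -> csupp h ->
  intRd (fun y => f y + h y) = intRd f + intRd h.
Proof.
move=> cf ch; rewrite -[intRd f]mul1r -intRd_lin //.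
by congr intRd; apply/funext => y; rewrite mul1r.
Qed.

(** The trailing [+ 0] gives every level of the nested sum the shape [a * f y + g y] of
    [csupp_lin]. *)
Lemma intRd_lin3 a b c (f g h : 'rV[R]_d -> R) : csupp f -> csupp g -> csupp h ->
  intRd (fun y => a * f y + (b * g y + (c * h y + 0))) =
  a * intRd f + (b * intRd g + c * intRd h).
Proof.
move=> cf cg ch; have z0 := csupp_zero.
rewrite (intRd_lin a cf (csupp_lin b cg (csupp_lin c ch z0))).
by rewrite (intRd_lin b cg (csupp_lin c ch z0)) (intRd_lin c ch z0) intRd0 addr0.
Qed.

Definition kern g u p (lam : R) :=
  intRd (fun y => u y * (lam ^- d * g (sq (lam^-1 *: (y - p))))).

Definition radial_profile g := cutoff_bdd test_cut g /\ continuous g.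

Lemma radial_profile_prof : radial_profile prof.
Proof. by split; [exact: cutoff_bdd_prof|exact: is_derive_continuous (@is_derive_prof R d)]. Qed.

Lemma radial_profile_lap_prof : radial_profile lap_prof.
Proof. by split; [exact: cutoff_bdd_lap_prof|exact: is_derive_continuous (@is_derive_lap_prof R d)]. Qed.

Lemma radial_profile_out g y i : radial_profile g -> 1 < `|y 0 i| -> g (sq y) = 0.
Proof.
move=> [[g0 _] _] yi; apply: g0; rewrite leNgt; apply/negP => /ltW /(sq_coord i) h.
have := test_rad_le R d; have := test_rad_gt0 R d; move: (le_trans (ltW yi) h); lra.
Qed.

Lemma kern_out g y p lam i : radial_profile g -> 0 < lam -> lam + `|p| < `|y 0 i| ->
  g (sq (lam^-1 *: (y - p))) = 0.
Proof.
move=> kg l0 yi; apply: (@radial_profile_out _ _ i) => //.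
rewrite mxE normrM gtr0_norm ?invr_gt0 // mulrC ltr_pdivlMr // mul1r.
have := coord_norm_le p i; rewrite mxE [X in _ + X]mxE.
have := ler_normD (y 0 i - p 0 i) (p 0 i); rewrite subrK.
by move: yi; lra.
Qed.

Lemma kern_csupp_in g u p lam : radial_profile g -> continuous u -> 0 < lam ->
  csupp_in (lam + `|p|) (fun y => u y * (lam ^- d * g (sq (lam^-1 *: (y - p))))).
Proof.
move=> kg cu l0; split => [|y i yi]; last by rewrite (kern_out kg l0 yi) !mulr0.
apply: contM cu _; apply: contM; first exact: contcst.
apply: (cont_comp (g := fun y => sq (lam^-1 *: (y - p)))); last exact: kg.2.
apply: (cont_comp (g := fun y => lam^-1 *: (y - p))); last exact: cont_sq.
rewrite (_ : (fun y => _) = fun y => lam^-1 *: y + - (lam^-1 *: p)).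
  exact: cont_affine.
by apply/funext => y; rewrite scalerBr.
Qed.

Lemma kern_csupp g u p lam : radial_profile g -> continuous u -> 0 < lam ->
  csupp (fun y => u y * (lam ^- d * g (sq (lam^-1 *: (y - p))))).
Proof.
move=> kg cu l0; exists (lam + `|p|); first by rewrite addr_ge0 // ltW.
exact: kern_csupp_in.
Qed.

Lemma std_csupp_in g u : radial_profile g -> continuous u -> csupp_in 1 (fun z => u z * g (sq z)).
Proof.
move=> kg cu; split => [|y i yi]; last by rewrite (radial_profile_out kg yi) mulr0.
apply: contM cu _; apply: (cont_comp (g := @sq R d)); [exact: cont_sq | exact: kg.2].
Qed.

Lemma std_csupp g u : radial_profile g -> continuous u -> csupp (fun z => u z * g (sq z)).
Proof. by move=> kg cu; exists 1 => //; exact: std_csupp_in. Qed.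

Lemma cont_aff u lam p : continuous u -> continuous (fun z => u (lam *: z + p)).
Proof. by move=> cu; apply: (cont_comp (@cont_affine R d lam p)). Qed.

(** The substitution y = l z + p moves scale and centre from the kernel to [u]; bounds, parity and
    rescaling are all read off from this form. *)
Lemma kern_change g u p lam : radial_profile g -> continuous u -> 0 < lam ->
  kern g u p lam = intRd (fun z => u (lam *: z + p) * g (sq z)).
Proof.
move=> kg cu l0; have ln : lam != 0 by rewrite gt_eqF.
have h := intRd_affine p (kern_csupp p kg cu l0) ln.
rewrite gtr0_norm // in h.
rewrite -/(kern g u p lam) in h.
have -> : kern g u p lam = lam ^+ d * (lam ^- d * kern g u p lam).
  by rewrite mulrA divff ?mul1r // expf_neq0.
rewrite -h -intRdZ.
  congr intRd; apply/funext => z; rewrite addrK scalerA mulVf // scale1r.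
  by rewrite mulrCA [_ * (_ * g _)]mulrA divff ?mul1r // expf_neq0.
rewrite (_ : (fun _ => _) = fun z => lam ^- d * (u (lam *: z + p) * g (sq z)) + 0).
  by apply: csupp_lin csupp_zero; have := std_csupp kg (@cont_aff _ lam p cu).
by apply/funext => z; rewrite addr0 addrK scalerA mulVf // scale1r mulrCA.
Qed.

(** The factor 2^d is the volume of the cube of half-width 1. A bound on [u] over the rescaled unit
    ball of [dist] is enough, since the kernel vanishes outside it. *)
Lemma kern_bound g u p lam S M : radial_profile g -> continuous u -> 0 < lam ->
  0 <= S -> 0 <= M -> (forall s, 0 <= s -> `|g s| <= M) ->
  (forall z, dist 0 z < 1 -> `|u (lam *: z + p)| <= S) ->
  `|kern g u p lam| <= 2 ^+ d * (S * M).
Proof.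
move=> kg cu l0 S0 M0 gM uS; rewrite kern_change // -[X in X ^+ d]mulr1.
apply: intRd_bound => //; first by have := std_csupp_in kg (@cont_aff _ lam p cu).
move=> z; have [zc|zc] := leP test_cut (sq z).
  by rewrite kg.1.1 // mulr0 normr0 mulr_ge0.
rewrite normrM ler_pM // ?gM ?sq_ge0 // uS //.
exact/sq_dist/ltW.
Qed.

Lemma kernD g u v p lam : radial_profile g -> continuous u -> continuous v -> 0 < lam ->
  kern g (fun y => u y + v y) p lam = kern g u p lam + kern g v p lam.
Proof.
move=> kg cu cv l0; rewrite -intRdD; try exact: kern_csupp.
by congr intRd; apply/funext => y; rewrite mulrDl.
Qed.

Lemma kernZ g u a p lam : radial_profile g -> continuous u -> 0 < lam ->
  kern g (fun y => a * u y) p lam = a * kern g u p lam.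
Proof.
move=> kg cu l0; rewrite -intRdZ; last exact: kern_csupp.
by congr intRd; apply/funext => y; rewrite mulrA.
Qed.

(** Affine functions encoded without coefficients. The midpoint identity is exactly what an even
    kernel sees, and it passes directly to rescalings and to real and imaginary parts. *)
Definition midaff (P : 'rV[R]_d -> R) := continuous P /\
  forall p y, P (p + y) + P (p - y) = 2 * P p.

Definition radial_mass g := intRd (fun y : 'rV[R]_d => g (sq y)).

(** Reflecting z to -z leaves the kernel unchanged; adding the two integrals replaces [P] by the
    constant [2 * P p]. *)
Lemma kern_midaff g P p lam : radial_profile g -> midaff P -> 0 < lam ->
  kern g P p lam = radial_mass g * P p.
Proof.
move=> kg [cP mP] l0; rewrite kern_change //.
set I := intRd _.
have c1 : csupp (fun z => P (lam *: z + p) * g (sq z)).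
  have := std_csupp kg (@cont_aff _ lam p cP); exact.
have I2 : intRd (fun z => P (- lam *: z + p) * g (sq z)) = I.
  have := intRd_affine 0 c1 (_ : -1 != 0); rewrite oppr_eq0 oner_eq0 => /(_ isT).
  rewrite normrN1 expr1n invr1 mul1r -/I => <-.
  congr intRd; apply/funext => z; rewrite addr0 scalerA mulrN1.
  by rewrite scaleN1r sqN.
have e : I + I = 2 * (radial_mass g * P p).
  rewrite -{2}I2 -intRdD //; last by have := std_csupp kg (@cont_aff _ (- lam) p cP).
  rewrite mulrCA mulrC -intRdZ; last first.
    have := @std_csupp g (fun=> 1) kg cont1.
    by congr csupp; apply/funext => z; rewrite mul1r.
  congr intRd; apply/funext => z; rewrite -mulrDl scaleNr [lam *: z + p]addrC.
  by rewrite [- _ + p]addrC mP.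
by lra.
Qed.

Lemma bounded_cube u M : continuous u -> exists2 S, 0 <= S &
  forall y, (forall i, `|y 0 i| <= M) -> `|u y| <= S.
Proof.
move=> cu.
pose K : set 'rV[R]_d := [set v | forall i, `[- M, M]%classic (v ord0 i)].
have cK : compact K.
  by apply: (@rV_compact _ _ (fun=> `[- M, M]%classic)) => _; exact: segment_compact.
have [S [_ bS]] : bounded_set (u @` K).
  apply: compact_bounded; apply: continuous_compact => //.
  exact: continuous_subspaceT.
exists (`|S| + 1); first by rewrite addr_ge0.
move=> y yM; apply: (bS (`|S| + 1)); first by rewrite (le_lt_trans (ler_norm _)) // ltrDl.
by exists y => // i /=; rewrite in_itv /= -ler_norml.
Qed.

Lemma sq_inv a y : sq (a^-1 *: y) = sq y / a ^+ 2.
Proof. by rewrite sqZ exprVn mulrC. Qed.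

(** Differentiation under the integral: for scales between lam / 2 and 2 lam the kernel has a second
    derivative in the scale bounded uniformly in y, so the pointwise Taylor error integrates to a
    quadratic error. *)
Lemma is_derive_kern u p lam : continuous u -> 0 < lam ->
  is_d (kern prof u p) lam (- (lam^-1 * kern lap_prof u p lam)).
Proof.
move=> cu l0.
(* The profile of the second derivative in the scale: [is_derive_profile] with n = d + 1 applied to
   [lap_prof]. *)
pose f2 s := d.+1%:R * lap_prof s + 2 * s * dlap_prof d s.
have [_ [B B0 f2B]] : cutoff_bdd test_cut f2.
  have := cutoff_bdd_lin d.+1%:R 2 (cutoff_bdd_lap_prof R d) (cutoff_bdd_id (ltW (test_cut_gt0 R d)) (cutoff_bdd_dlap_prof R d)).
  by congr cutoff_bdd; apply/funext => s; rewrite /f2 mulrA.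
(* Half-width of a cube containing the supports of all kernels centred at [p] with scale at most
   [2 * lam]. *)
pose M := 2 * lam + `|p|.
have M0 : 0 <= M by rewrite addr_ge0 // mulr_ge0 // ltW.
have [S S0 uS] := bounded_cube M cu.
pose C0 := (lam / 2) ^- d.+2 * B.
have C00 : 0 <= C0 by rewrite mulr_ge0 // invr_ge0 exprn_ge0 // ltW // divr_gt0.
apply: (@is_derive_quad _ _ _ _ ((2 * M) ^+ d * (S * C0)) (lam / 2)).
  by rewrite divr_gt0.
move=> h hl; have hl0 : 0 < h + lam by move: hl; rewrite ler_norml; lra.
have hl1 : lam / 2 <= h + lam <= 2 * lam by move: hl; rewrite ler_norml; lra.
have hl2 : lam / 2 <= lam <= 2 * lam by lra.
pose w y l := l ^- d * prof (sq y / l ^+ 2).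
pose w1 y l := - (l ^- d.+1 * lap_prof (sq y / l ^+ 2)).
have dw y (z : R) : lam / 2 <= z <= 2 * lam -> is_d (w y) z (w1 y z).
  move=> zl; have z0 : z != 0 by rewrite gt_eqF //; lra.
  have := is_derive_profile d (sq y) z0 (@is_derive_prof R d).
  exact.
have dw1 y (z : R) : lam / 2 <= z <= 2 * lam ->
    is_d (w1 y) z (z ^- d.+2 * f2 (sq y / z ^+ 2)).
  move=> zl; have z0 : z != 0 by rewrite gt_eqF //; lra.
  have := is_deriveN (is_derive_profile d.+1 (sq y) z0 (@is_derive_lap_prof R d)).
  rewrite opprK; exact.
have bw y (z : R) : lam / 2 <= z <= 2 * lam -> `|z ^- d.+2 * f2 (sq y / z ^+ 2)| <= C0.
  move=> zl; have z0 : 0 < z by lra.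
  rewrite normrM ger0_norm ?invr_ge0 ?exprn_ge0 ?(ltW z0) // ler_pM //.
  - by rewrite invr_ge0 exprn_ge0 // ltW.
  - rewrite lef_pV2 ?posrE ?exprn_gt0 ?divr_gt0 //.
    by rewrite lerXn2r ?nnegrE ?(ltW z0) //; lra.
  - by rewrite f2B // divr_ge0 ?sq_ge0 // exprn_ge0 // ltW.
have T y := taylor2 (dw y) (dw1 y) (bw y) hl2 hl1.
pose K1 y := u y * ((h + lam) ^- d * prof (sq ((h + lam)^-1 *: (y - p)))).
pose K2 y := u y * (lam ^- d * prof (sq (lam^-1 *: (y - p)))).
pose K3 y := u y * (lam ^- d * lap_prof (sq (lam^-1 *: (y - p)))).
pose K y := 1 * K1 y + (-1 * K2 y + (h * lam^-1 * K3 y + 0)).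
have c1 : csupp K1 := kern_csupp p radial_profile_prof cu hl0.
have c2 : csupp K2 := kern_csupp p radial_profile_prof cu l0.
have c3 : csupp K3 := kern_csupp p radial_profile_lap_prof cu l0.
have -> : kern prof u p (h + lam) - kern prof u p lam - h * - (lam^-1 * kern lap_prof u p lam) =
   intRd K.
  have -> : intRd K = 1 * kern prof u p (h + lam) +
      (-1 * kern prof u p lam + h * lam^-1 * kern lap_prof u p lam) := intRd_lin3 1 (-1) (h * lam^-1) c1 c2 c3.
  by move: (kern prof u p _) (kern prof u p _) (kern lap_prof u p _) => k1 k2 k3; ring.
have eK y : K y = u y * (w (y - p) (h + lam) - w (y - p) lam - (h + lam - lam) * w1 (y - p) lam).
  rewrite /K /K1 /K2 /K3 !sq_inv /w /w1 [lam ^+ d.+1]exprS; field.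
  have ln : lam != 0 by rewrite gt_eqF.
  have hn : h + lam != 0 by rewrite gt_eqF.
  by rewrite ln !expf_neq0.
have cK : csupp_in M K.
  have hlM : h + lam + `|p| <= M by rewrite lerD2r; case/andP: hl1.
  have lM : lam + `|p| <= M by rewrite lerD2r; case/andP: hl2.
  apply: csupp_in_lin; first exact: csupp_in_mono hlM (kern_csupp_in p radial_profile_prof cu hl0).
  apply: csupp_in_lin; first exact: csupp_in_mono lM (kern_csupp_in p radial_profile_prof cu l0).
  apply: csupp_in_lin; first exact: csupp_in_mono lM (kern_csupp_in p radial_profile_lap_prof cu l0).
  by split => //; exact: contcst.
rewrite -(mulrA _ (S * C0)) -(mulrA S C0); apply: intRd_bound => // y.
have [[i yi]|yM] := pselect (exists i, M < `|y 0 i|).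
  by rewrite (cK.2 y i) // normr0 mulr_ge0 // mulr_ge0 // sqr_ge0.
have {}yM i : `|y 0 i| <= M by rewrite leNgt; apply/negP => h'; apply: yM; exists i.
rewrite eK normrM ler_pM // ?uS //.
have -> : h ^+ 2 = (h + lam - lam) ^+ 2 by rewrite addrK.
exact: T.
Qed.

(** The mass of the rescaled [prof] does not depend on the scale; its derivative at scale 1 is both
    zero and minus the mass of [lap_prof]. *)
Lemma radial_mass_lap_prof : radial_mass lap_prof = 0.
Proof.
have a1 : midaff (fun=> 1) by split; [exact: contcst | move=> *; ring].
have h1 := is_derive_kern (0 : 'rV[R]_d) cont1 (ltr01 : 0 < (1 : R)).
have h2 : is_d (kern prof (fun=> 1) 0) 1 0.
  apply: (@near_eq_is_derive _ _ _ (fun=> radial_mass prof)).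
    near=> l; rewrite (kern_midaff _ radial_profile_prof a1) ?mulr1 //.
    by near: l; apply: lt_nbhsr.
have [_ e1] := h1; have [_ e2] := h2.
move: e1; rewrite e2 (kern_midaff _ radial_profile_lap_prof a1) // invr1 mul1r mulr1 => /eqP.
by rewrite eq_sym oppr_eq0 => /eqP.
Unshelve. all: by end_near. Qed.

Lemma radial_mass_prof_gt0 : 0 < radial_mass prof.
Proof.
have [C C0 pC] := prof_lb R d.
have r0 := test_rad_gt0 R d.
have := @intRd_ge R d.
have c1 : csupp (fun z : 'rV[R]_d => prof (sq z)).
  have := @std_csupp prof (fun=> 1) radial_profile_prof cont1.
  by congr csupp; apply/funext => z; rewrite mul1r.
(* On this cube [sq y] is at most d D1 test_rad = test_rad^2 d / (2d + 2), below [test_cut / 2],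
   where [prof_lb] applies. *)
pose D1 := test_rad / (d.*2.+2)%:R.
have D10 : 0 < D1 by rewrite divr_gt0 // ltr0n.
move=> /(_ D1 C _ D10 (ltW C0) c1 (fun y => prof_ge0 d (sq y))) h.
apply: lt_le_trans (h _); first by rewrite mulr_gt0 // exprn_gt0 // mulr_gt0.
move=> y yD; apply: pC; rewrite sq_ge0 /=.
have : sq y <= \sum_(i < d) D1 * test_rad.
  apply: ler_sum => i _; rewrite -real_normK ?num_real // expr2 ler_pM //.
  apply: le_trans (yD i) _; rewrite ler_pdivrMr ?ltr0n // ler_peMr ?(ltW r0) //.
  by rewrite ler1n.
move=> /le_trans; apply; rewrite sumr_const card_ord -(mulr_natl (D1 * test_rad) d) /D1.
rewrite (_ : d%:R * _ = test_rad ^+ 2 * (d%:R / (d.*2.+2)%:R)); last by ring.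
rewrite ler_wpM2l ?sqr_ge0 // ler_pdivrMr ?ltr0n //.
by rewrite -ler_pdivrMl // invrK -natrM ler_nat mul2n; exact: leq_trans (leqnSn _).
Qed.

End kernels.

(** * Second differences of averages at a large scale *)

Section diff2.
Variables (R : realType) (d : nat).
Implicit Types (x y z p q : 'rV[R]_d) (u v : 'rV[R]_d -> R) (g : R -> R).
Local Notation is_d f x l := (is_derive (x : R) (1 : R) (f : R -> R) (l : R)).
Local Notation test_cut := (test_cut R d).
Local Notation test_rad := (test_rad R d).
Local Notation prof := (@prof R d).
Local Notation dprof := (@dprof R d).
Local Notation ddprof := (@ddprof R d).

Lemma coord_le_dist q i : `|q 0 i| <= dist 0 q.
Proof. by rewrite dist0E (bigD1 i) //= lerDl; apply: sumr_ge0. Qed.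

Lemma dist0_ge0 q : 0 <= dist 0 q.
Proof. by apply: sumr_ge0. Qed.

Lemma sq_le_dist q : sq q <= dist 0 q ^+ 2.
Proof.
rewrite expr2 [X in X * _]dist0E mulr_suml; apply: ler_sum => i _.
by rewrite -real_normK ?num_real // expr2 ler_wpM2l // coord_le_dist.
Qed.

(** Along t, prof(|z - t q|^2) is expanded at t = 1/2 and evaluated at 0 and 1: the linear terms
    cancel, and the second derivative is of order |q|^2 uniformly in [z]. *)
Lemma prof_diff2 : exists2 B : R, 0 <= B & forall z q,
  `|prof (sq (z - q)) - 2 * prof (sq (z - 2^-1 *: q)) + prof (sq z)| <= B * dist 0 q ^+ 2.
Proof.
have [d0 [M M0 dM]] := cutoff_bdd_dprof R d.
have [dd0 [N N0 ddN]] := cutoff_bdd_ddprof R d.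
exists (N + 2 * M); first by rewrite addr_ge0 // mulr_ge0.
move=> z q; set r := dist 0 q.
have r0 : 0 <= r := dist0_ge0 q.
pose b := \sum_i (- 2) * (z 0 i * q 0 i).
pose Q t := sq (z - t *: q).
have QE t : Q t = sq z + b * t + sq q * t ^+ 2.
  rewrite /Q /sq /b !mulr_suml -!big_split /=; apply: eq_bigr => i _.
  by rewrite !mxE; ring.
have dQ t : is_d Q t (b + 2 * sq q * t).
  apply: (@is_derive_quad _ _ _ _ (sq q) 1) => // h _.
  rewrite !QE (_ : _ - _ = sq q * h ^+ 2); last by ring.
  by rewrite ger0_norm // mulr_ge0 ?sq_ge0 ?sqr_ge0.
(* For large [z] the slope of [Q] is unbounded, but only [Q t <= test_cut] matters: beyond it
   [dprof] and [ddprof] vanish. *)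
have bQ t : Q t <= test_cut -> `|b + 2 * sq q * t| <= r.
  move=> Qc.
  have -> : b + 2 * sq q * t = \sum_i (- 2) * ((z - t *: q) 0 i * q 0 i).
    rewrite /b /sq mulr_sumr mulr_suml -big_split /=; apply: eq_bigr => i _.
    by rewrite !mxE; ring.
  rewrite /r dist0E; apply: le_trans (ler_norm_sum _ _ _) _; apply: ler_sum => i _.
  have -> : `|- 2 * ((z - t *: q) 0 i * q 0 i)| = (2 * `|(z - t *: q) 0 i|) * `|q 0 i|.
    by rewrite !normrM normrN (ger0_norm (_ : 0 <= 2 :> R)) // mulrA.
  rewrite ler_piMl //.
  apply: le_trans (test_rad_le R d); rewrite ler_wpM2l //; exact: sq_coord.
pose g1 t := dprof (Q t) * (b + 2 * sq q * t).
pose g2 t := dprof (Q t) * (2 * sq q) + (b + 2 * sq q * t) * (ddprof (Q t) * (b + 2 * sq q * t)).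
have dg t : 0 <= t <= 1 -> is_d (fun t => prof (Q t)) t (g1 t).
  by move=> _; exact: is_derive1_comp (is_derive_prof _ _) (dQ t).
have dg1 t : 0 <= t <= 1 -> is_d g1 t (g2 t).
  move=> _.
  have dl : is_d (fun t => b + 2 * sq q * t) t (2 * sq q).
    apply: (@is_derive_quad _ _ _ _ 0 1) => // h _.
    by rewrite mul0r normr_le0; apply/eqP; ring.
  exact: is_deriveM (is_derive1_comp (is_derive_dprof _ _) (dQ t)) dl.
have bg t : 0 <= t <= 1 -> `|g2 t| <= (N + 2 * M) * r ^+ 2.
  move=> _; have [cQ|Qc] := leP test_cut (Q t).
    rewrite /g2 d0 // dd0 // !mul0r mulr0 addr0 normr0 mulr_ge0 ?sqr_ge0 //.
    by rewrite addr_ge0 // mulr_ge0.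
  have bt := bQ t (ltW Qc); have Q0 : 0 <= Q t := sq_ge0 _.
  rewrite mulrDl addrC; apply: le_trans (ler_normD _ _) _; apply: lerD.
    rewrite normrM (ger0_norm (_ : 0 <= 2 * sq q)) ?mulr_ge0 ?sq_ge0 //.
    rewrite [2 * M]mulrC -mulrA ler_pM ?dM ?mulr_ge0 ?sq_ge0 //.
    by rewrite ler_wpM2l // sq_le_dist.
  have h1 := ddN _ Q0.
  have h2 : `|b + 2 * sq q * t| * `|b + 2 * sq q * t| <= r * r by rewrite ler_pM.
  move: (b + 2 * sq q * t) bt h2 => w bt h2.
  have -> : w * (ddprof (Q t) * w) = ddprof (Q t) * (w * w) by ring.
  by rewrite normrM [X in _ * X]normrM expr2; apply: ler_pM => //; rewrite mulr_ge0.
have h2 : 0 <= (2^-1 : R) <= 1 by apply/andP; split; lra.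
have h0 : 0 <= (0 : R) <= 1 by rewrite lexx ler01.
have h1 : 0 <= (1 : R) <= 1 by rewrite lexx ler01.
have := taylor2 dg dg1 bg h2 h1; have := taylor2 dg dg1 bg h2 h0.
rewrite /Q scale1r scale0r subr0.
have k : 0 <= (N + 2 * M) * r ^+ 2 by rewrite mulr_ge0 ?sqr_ge0 // addr_ge0 // mulr_ge0.
move: k; move: ((N + 2 * M) * r ^+ 2) (g1 2^-1) (prof _) (prof _) (prof _) => B w a1 a2 a3 B0.
have -> : (0 - 2^-1 : R) ^+ 2 = 4^-1 by field.
have -> : (1 - 2^-1 : R) ^+ 2 = 4^-1 by field.
by rewrite !ler_norml; lra.
Qed.

Lemma norm_le_dist p : `|p| <= dist 0 p.
Proof. by apply: rv_norm_le => [|i]; [exact: dist0_ge0 | exact: coord_le_dist]. Qed.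

Lemma distZ0 a p : dist 0 (a *: p) = `|a| * dist 0 p.
Proof. by rewrite !dist0E mulr_sumr; apply: eq_bigr => i _; rewrite mxE normrM. Qed.

(** The second difference is put on the kernel, where it gains r^-2. Since r >= 1, all supports lie
    in the cube of half-width 2 r, of volume (4 r)^d, on which |v| is at most N (2 d r)^eta; the
    factor r^-d of the kernel cancels the volume. *)
Lemma kern_diff2 (eta : R) : 0 <= eta -> exists2 C : R, 0 <= C & forall v N r p,
  continuous v -> 1 <= r -> 0 <= N -> dist 0 p <= 1 ->
  (forall z, `|v z| <= N * dist 0 z `^ eta) ->
  `|kern prof v p r - 2 * kern prof v (2^-1 *: p) r + kern prof v 0 r| <=
  C * N * r `^ (eta - 2).
Proof.
move=> eta0; have [B B0 pB] := prof_diff2.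
exists (4 ^+ d * ((d%:R * 2) `^ eta * B)).
  by rewrite mulr_ge0 ?exprn_ge0 // mulr_ge0 // powR_ge0.
move=> v N r p cv r1 N0 p1 vN.
have r0 : 0 < r by lra.
have kp := @radial_profile_prof R d.
pose K1 y := v y * (r ^- d * prof (sq (r^-1 *: (y - p)))).
pose K2 y := v y * (r ^- d * prof (sq (r^-1 *: (y - 2^-1 *: p)))).
pose K3 y := v y * (r ^- d * prof (sq (r^-1 *: (y - 0)))).
pose K y := 1 * K1 y + (- 2 * K2 y + (1 * K3 y + 0)).
have c1 : csupp K1 := kern_csupp p kp cv r0.
have c2 : csupp K2 := kern_csupp (2^-1 *: p) kp cv r0.
have c3 : csupp K3 := kern_csupp 0 kp cv r0.
have -> : kern prof v p r - 2 * kern prof v (2^-1 *: p) r + kern prof v 0 r = intRd K.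
  have -> : intRd K = 1 * kern prof v p r +
      (- 2 * kern prof v (2^-1 *: p) r + 1 * kern prof v 0 r) := intRd_lin3 1 (- 2) 1 c1 c2 c3.
  by move: (kern prof v p r) (kern prof v _ r) (kern prof v 0 r) => k1 k2 k3; ring.
have cK : csupp_in (2 * r) K.
  have pr q : dist 0 q <= 1 -> r + `|q| <= 2 * r.
    by move=> q1; have := norm_le_dist q; lra.
  apply: csupp_in_lin; first exact: csupp_in_mono (pr _ p1) (kern_csupp_in p kp cv r0).
  apply: csupp_in_lin.
    apply: csupp_in_mono (kern_csupp_in (2^-1 *: p) kp cv r0); apply: pr.
    rewrite distZ0 gtr0_norm ?invr_gt0 //; lra.
  apply: csupp_in_lin.
    apply: csupp_in_mono (kern_csupp_in 0 kp cv r0); apply: pr.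
    by rewrite dist0E big1 // => i _; rewrite mxE normr0.
  by split => //; exact: contcst.
have -> : 4 ^+ d * ((d%:R * 2) `^ eta * B) * N * r `^ (eta - 2) =
  (2 * (2 * r)) ^+ d * (N * (d%:R * (2 * r)) `^ eta * (r ^- d * (B * r ^- 2))).
  rewrite (_ : d%:R * (2 * r) = (d%:R * 2) * r); last by ring.
  rewrite (@powRM _ (d%:R * 2)) ?mulr_ge0 ?ler0n ?(ltW r0) //.
  rewrite powRB; last by rewrite (gt_eqF r0) implybT.
  rewrite (_ : r `^ 2 = r ^+ 2) ?powR_mulrn ?(ltW r0) //.
  rewrite !exprMn (_ : 4 = 2 * 2); last by ring.
  rewrite !exprMn; field.
  by rewrite expf_neq0 ?gt_eqF.
apply: intRd_bound => //; first by lra.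
move=> y.
have S0 : 0 <= r ^- d * (B * r ^- 2).
  by rewrite mulr_ge0 ?invr_ge0 ?exprn_ge0 ?(ltW r0) // mulr_ge0 // invr_ge0 sqr_ge0.
have [[i yi]|yM] := pselect (exists i, 2 * r < `|y 0 i|).
  by rewrite (cK.2 y i) // normr0 mulr_ge0 // mulr_ge0 // powR_ge0.
have {}yM i : `|y 0 i| <= 2 * r by rewrite leNgt; apply/negP => h'; apply: yM; exists i.
have -> : K y = v y * (r ^- d * (prof (sq (r^-1 *: y - r^-1 *: p)) -
    2 * prof (sq (r^-1 *: y - 2^-1 *: (r^-1 *: p))) + prof (sq (r^-1 *: y)))).
  rewrite /K /K1 /K2 /K3 subr0 !scalerBr !scalerA [r^-1 * _]mulrC.
  by move: (prof _) (prof _) (prof _) => a1 a2 a3; ring.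
rewrite normrM; apply: ler_pM => //.
  apply: le_trans (vN y) _; rewrite ler_wpM2l //.
  apply: ge0_ler_powR => //; rewrite ?nnegrE ?dist0_ge0 ?mulr_ge0 ?(ltW r0) //.
  rewrite dist0E; apply: (@le_trans _ _ (\sum_(i < d) (2 * r))).
    by apply: ler_sum.
  by rewrite sumr_const card_ord -(mulr_natl (2 * r) d).
rewrite normrM ger0_norm ?invr_ge0 ?exprn_ge0 ?(ltW r0) // ler_wpM2l //.
  by rewrite invr_ge0 exprn_ge0 // ltW.
apply: le_trans (pB _ _) _; rewrite ler_wpM2l // distZ0 exprMn.
rewrite gtr0_norm ?invr_gt0 // exprVn ler_piMr ?invr_ge0 ?sqr_ge0 //.
by rewrite exprn_ile1 // dist0_ge0.
Qed.

End diff2.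

(** * The estimate at unit scale *)

Section core.
Variables (R : realType) (d : nat) (alpha eta : R).
Hypothesis alpha01 : 0 < alpha < 1.
Hypothesis eta12 : 1 < eta < 2.
Implicit Types (x y z p q : 'rV[R]_d) (u v : 'rV[R]_d -> R).
Local Notation is_d f x l := (is_derive (x : R) (1 : R) (f : R -> R) (l : R)).
Local Notation prof := (@prof R d).
Local Notation lap_prof := (@lap_prof R d).

Lemma powR_small_arg t : 0 < t -> exists2 e : R, 0 < e <= 1 & e `^ eta <= t.
Proof.
move=> t0; pose m := Num.min t 1.
have m0 : 0 < m by rewrite lt_min t0 ltr01.
have m1 : m <= 1 by rewrite ge_min lexx orbT.
have e0 : 0 < eta by move: eta12; lra.
exists (m `^ eta^-1).
  rewrite powR_gt0 //=; have := @ge0_ler_powR R eta^-1 _ m 1.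
  rewrite powR1; apply => //; rewrite ?nnegrE ?invr_ge0 // ltW //.
by rewrite -powRrM mulVf ?gt_eqF // powRr1 ?(ltW m0) // ge_min lexx.
Qed.

Lemma powR_large_arg t : 0 < t -> exists2 r : R, 1 <= r & r `^ (eta - 2) <= t.
Proof.
move=> t0; pose m := Num.min t 1.
have m0 : 0 < m by rewrite lt_min t0 ltr01.
have m1 : m <= 1 by rewrite ge_min lexx orbT.
have e0 : 0 < 2 - eta by move: eta12; lra.
have q : m `^ (2 - eta)^-1 <= 1.
  have := @ge0_ler_powR R (2 - eta)^-1 _ m 1.
  rewrite powR1; apply => //; rewrite ?nnegrE ?invr_ge0 // ltW //.
have q0 : 0 < m `^ (2 - eta)^-1 by rewrite powR_gt0.
exists (m `^ (- (2 - eta)^-1)).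
  by rewrite powRN invf_ge1.
rewrite -powRrM (_ : - _ * _ = 1); last by field; rewrite gt_eqF.
by rewrite powRr1 ?(ltW m0) // ge_min lexx.
Qed.

(* What is used of [v z := r^-eta * U_x (x + r z)]: at [p], [V] and [P] are the rescalings of
   [U_(x + r p)] and of the polynomial compared with [U_x - U_(x + r p)]. *)
Definition split_at (A B N : R) v := forall p, dist 0 p <= 1 ->
  exists V P, [/\ continuous V, midaff P,
    (forall z, `|V z| <= N * dist p z `^ eta),
    (forall z, `|v z - V z - P z| <= B * dist p z `^ alpha * (1 + dist p z) `^ (eta - alpha)) &
    forall l, 0 < l -> `|kern lap_prof V p l| <= A * l `^ eta].

Lemma dist_affine p l z : 0 <= l -> dist p (l *: z + p) = l * dist 0 z.
Proof.
move=> l0; rewrite /dist mulr_sumr; apply: eq_bigr => i _; rewrite !mxE.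
by rewrite opprD addrCA subrr addr0 sub0r !normrN normrM ger0_norm.
Qed.

Lemma dist_refl p : dist p p = 0.
Proof. by rewrite /dist big1 // => i _; rewrite subrr normr0. Qed.

(** Size, up to the factor [B], of the remainder at distance l from [p] when the two base points are
    at distance at most 1. *)
Definition rate l : R := l `^ alpha * (1 + l) `^ (eta - alpha).

Lemma rate_mono a b : 0 <= a -> a <= b -> rate a <= rate b.
Proof.
move=> a0 ab; have b0 := le_trans a0 ab.
have [al0 ea0] : 0 <= alpha /\ 0 <= eta - alpha by move: alpha01 eta12; lra.
apply: ler_pM; rewrite ?powR_ge0 //; apply: ge0_ler_powR; rewrite ?nnegrE //.
- by lra.
- by lra.
- by lra.
Qed.

Lemma rate_ge0 l : 0 <= rate l.
Proof. by rewrite mulr_ge0 ?powR_ge0. Qed.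

Lemma remainder_bound v V P p B l z : 0 <= B -> 0 < l -> dist 0 z < 1 ->
  (forall z, `|v z - V z - P z| <= B * dist p z `^ alpha * (1 + dist p z) `^ (eta - alpha)) ->
  `|v (l *: z + p) - V (l *: z + p) - P (l *: z + p)| <= B * rate l.
Proof.
move=> B0 l0 z1 h; apply: le_trans (h _) _; rewrite dist_affine ?(ltW l0) //.
rewrite -mulrA ler_wpM2l //; apply: rate_mono.
  by rewrite mulr_ge0 ?(ltW l0) // dist0_ge0.
by rewrite ler_piMr // ltW.
Qed.

Lemma cont_rem v V P : continuous v -> continuous V -> continuous P ->
  continuous (fun z => v z - V z - P z).
Proof.
move=> cv cV cP.
rewrite (_ : (fun _ => _) = fun z => (v z + -1 * V z) + -1 * P z); last first.
  by apply/funext => z; rewrite !mulN1r.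
have cm : continuous (fun _ : 'rV[R]_d => -1 : R) by exact: contcst.
by apply: contD; [apply: contD => //; exact: contM | exact: contM].
Qed.

Lemma kern_split g v V P p l : radial_profile d g -> continuous v -> continuous V -> midaff P -> 0 < l ->
  kern g v p l = kern g V p l + radial_mass d g * P p + kern g (fun z => v z - V z - P z) p l.
Proof.
move=> kg cv cV mP l0; have cP := mP.1.
rewrite -(kern_midaff p kg mP l0) -!kernD //; last 2 first.
- exact: contD.
- exact: cont_rem.
by congr (kern g _ p l); apply/funext => z; ring.
Qed.

Lemma kern_lap_prof_bound : exists2 M : R, 0 <= M & forall v A B N p l, 0 <= A -> 0 <= B ->
  continuous v -> split_at A B N v -> dist 0 p <= 1 -> 0 < l ->
  `|kern lap_prof v p l| <= A * l `^ eta + B * rate l * M.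
Proof.
have [_ [M M0 bM]] := cutoff_bdd_lap_prof R d.
exists (2 ^+ d * M); first by rewrite mulr_ge0 // exprn_ge0.
move=> v A B N p l A0 B0 cv sv p1 l0.
have [V [P [cV mP _ rem AV]]] := sv p p1.
rewrite (kern_split p (radial_profile_lap_prof R d) cv cV mP l0) radial_mass_lap_prof mul0r addr0.
apply: le_trans (ler_normD _ _) _; apply: lerD; first exact: AV.
rewrite mulrCA; apply: kern_bound => //; first exact: radial_profile_lap_prof.
- exact: cont_rem cv cV mP.1.
- by rewrite mulr_ge0 // rate_ge0.
- by move=> z z1; exact: remainder_bound rem.
Qed.

Lemma kern_prof_approx : exists2 M : R, 0 <= M & forall v A B N p l, 0 <= N -> 0 <= B ->
  continuous v -> split_at A B N v -> dist 0 p <= 1 -> 0 < l ->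
  `|radial_mass d prof * v p - kern prof v p l| <= M * (N * l `^ eta + B * rate l).
Proof.
have [_ [M M0 bM]] := cutoff_bdd_prof R d.
exists (2 ^+ d * M); first by rewrite mulr_ge0 // exprn_ge0.
move=> v A B N p l N0 B0 cv sv p1 l0.
have [V [P [cV mP bV rem _]]] := sv p p1.
have e0 : eta != 0 by rewrite gt_eqF //; move: eta12; lra.
have a0 : alpha != 0 by rewrite gt_eqF //; move: alpha01; lra.
(* Both [V] and the remainder vanish at [p], because their bounds carry a nonzero power of the
   distance to [p]. *)
have vp : v p = P p.
  have V0 : V p = 0.
    by apply/eqP; rewrite -normr_le0; have := bV p; rewrite dist_refl powR0 // mulr0.
  have := rem p; rewrite dist_refl powR0 // mulr0 mul0r normr_le0 V0 subr0 subr_eq0.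
  by move/eqP.
rewrite (kern_split p (radial_profile_prof R d) cv cV mP l0) vp.
set k1 := kern _ V _ _; set k2 := kern _ _ _ _.
have -> : radial_mass d prof * P p - (k1 + radial_mass d prof * P p + k2) = - (k1 + k2) by ring.
rewrite normrN mulrDr; apply: le_trans (ler_normD _ _) _; apply: lerD.
  rewrite -mulrA [M * _]mulrC; apply: kern_bound => //; first exact: radial_profile_prof.
    by rewrite mulr_ge0 // powR_ge0.
  move=> z z1; apply: le_trans (bV _) _; rewrite dist_affine ?(ltW l0) // ler_wpM2l //.
  have e00 : 0 <= eta by move: eta12; lra.
  apply: ge0_ler_powR => //; rewrite ?nnegrE ?mulr_ge0 ?dist0_ge0 ?(ltW l0) //.
  by rewrite ler_piMr ?(ltW l0) ?(ltW z1).
rewrite -mulrA [M * _]mulrC; apply: kern_bound => //; first exact: radial_profile_prof.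
- exact: cont_rem cv cV mP.1.
- by rewrite mulr_ge0 // rate_ge0.
- by move=> z z1; exact: remainder_bound rem.
Qed.

(** Mean value theorem in the scale, with 1 / l <= 1 / a. The crude factor (b - a) / a is harmless
    because both scales will be fixed constants. *)
Lemma kern_prof_scales v p a b D : continuous v -> 0 < a -> a <= b -> 0 <= D ->
  (forall l, a <= l <= b -> `|kern lap_prof v p l| <= D) ->
  `|kern prof v p b - kern prof v p a| <= (b - a) / a * D.
Proof.
move=> cv a0 ab D0 bD.
have dk l : a <= l <= b -> is_d (kern prof v p) l (- (l^-1 * kern lap_prof v p l)).
  by move=> /andP[al _]; apply: is_derive_kern => //; exact: lt_le_trans al.
have [l [lab ->]] := MVT_le ab dk.
have l0 : 0 < l by case/andP: lab => al _; exact: lt_le_trans al.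
rewrite normrM normrN normrM (gtr0_norm (_ : 0 < l^-1)) ?invr_gt0 //.
rewrite (ger0_norm (_ : 0 <= b - a)) ?subr_ge0 // mulrC -mulrA ler_wpM2l ?subr_ge0 //.
apply: ler_pM; rewrite ?invr_ge0 ?(ltW l0) //; last exact: bD.
by rewrite lef_pV2 ?posrE //; case/andP: lab.
Qed.

Lemma unit_scale : exists theta C : R, [/\ 0 <= theta < 1, 0 <= C &
  forall v A B N p, 0 <= A -> 0 <= B -> 0 <= N -> continuous v -> split_at A B N v ->
    (forall z, `|v z| <= N * dist 0 z `^ eta) -> dist 0 p <= 1 ->
    `|v p| <= (theta * N + C * (A + B)) ].
Proof.
have [M1 M10 H1] := kern_lap_prof_bound.
have [M2 M20 H2] := kern_prof_approx.
have eta0 : 0 <= eta by move: eta12; lra.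
have [M3 M30 H3] := @kern_diff2 R d eta eta0.
have m0 := radial_mass_prof_gt0 R d.
set m := radial_mass d prof in m0.
(* The contraction factor 2^(1 - eta) of the midpoint term. *)
pose th : R := 2 * 2^-1 `^ eta.
have th0 : 0 <= th by rewrite mulr_ge0 ?powR_ge0.
have th1 : th < 1.
  have h2 : (0 : R) < 2^-1 by rewrite invr_gt0.
  rewrite /th -(@mulr_powRB1 _ 2^-1 eta) ?(ltW h2) //; last by move: eta12; lra.
  rewrite mulrA divff // mul1r.
  have := @gt0_ltr_powR R (eta - 1) _ 2^-1 1; rewrite powR1; apply; rewrite ?nnegrE ?(ltW h2) //.
    by move: eta12; lra.
  by lra.
(* Half of the available gap, so that [th + sg] stays below 1. *)
pose sg := (1 - th) / 2.
have sg0 : 0 < sg by rewrite divr_gt0 // subr_gt0.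
have M2p : 0 < M2 + 1 by rewrite ltr_wpDl.
have M3p : 0 < M3 + 1 by rewrite ltr_wpDl.
(* The error at scale [e] enters with weights 1, 2, 1 at p, p / 2 and 0; the 8 makes its total N m
   sg / 2. The other half is left to the second difference at scale [r]. *)
have [e /andP[e0 e1] he] : exists2 e : R, 0 < e <= 1 & e `^ eta <= m * sg / (8 * (M2 + 1)).
  by apply: powR_small_arg; apply: divr_gt0; rewrite mulr_gt0.
have [r r1 hr] : exists2 r : R, 1 <= r & r `^ (eta - 2) <= m * sg / (2 * (M3 + 1)).
  by apply: powR_large_arg; apply: divr_gt0; rewrite mulr_gt0.
have r0 : 0 < r by lra.
have er : e <= r by lra.
pose D1 := r `^ eta + rate r * M1.
have D10 : 0 <= D1 by rewrite addr_ge0 ?powR_ge0 // mulr_ge0 ?rate_ge0.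
(* The coefficient of [A + B]: the remainder at scale [e], using e <= 1, plus the passage from [e]
   to [r]. *)
pose E1 := M2 * rate 1 + (r - e) / e * D1.
have re0 : 0 <= (r - e) / e by rewrite divr_ge0 ?subr_ge0 // ltW.
have E10 : 0 <= E1 by apply: addr_ge0; rewrite mulr_ge0 ?rate_ge0.
exists (th + sg), (4 * E1 / m); split.
- by rewrite addr_ge0 ?(ltW sg0) //= /sg; lra.
- by rewrite divr_ge0 ?mulr_ge0 // ltW.
move=> v A B N p A0 B0 N0 cv sv vN p1.
have K q : dist 0 q <= 1 ->
    `|m * v q - kern prof v q r| <= M2 * (N * e `^ eta) + E1 * (A + B).
  move=> q1.
  have h2 := H2 v A B N q e N0 B0 cv sv q1 e0.
  have h3 : `|kern prof v q r - kern prof v q e| <= (r - e) / e * (D1 * (A + B)).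
    apply: kern_prof_scales => //; first by rewrite mulr_ge0 // addr_ge0.
    move=> l /andP[el lr]; have l0 := lt_le_trans e0 el.
    apply: le_trans (H1 v A B N q l A0 B0 cv sv q1 l0) _.
    have a1 : A * l `^ eta <= A * r `^ eta.
      by rewrite ler_wpM2l // ge0_ler_powR // ?nnegrE // ltW.
    have a2 : B * rate l * M1 <= B * rate r * M1.
      by rewrite ler_wpM2r // ler_wpM2l // rate_mono // ltW.
    have a3 : 0 <= A * (rate r * M1) by apply: mulr_ge0 => //; rewrite mulr_ge0 ?rate_ge0.
    have a4 : 0 <= B * r `^ eta by rewrite mulr_ge0 ?powR_ge0.
    by rewrite /D1; move: a1 a2 a3 a4; lra.
  have b1 : M2 * (B * rate e) <= M2 * (rate 1 * (A + B)).
    rewrite ler_wpM2l // [rate 1 * _]mulrC ler_pM ?rate_ge0 ?lerDr //.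
    by apply: rate_mono => //; exact: ltW.
  rewrite (_ : _ - _ = (m * v q - kern prof v q e) - (kern prof v q r - kern prof v q e)); last by ring.
  apply: le_trans (ler_normB _ _) _; apply: le_trans (lerD h2 h3) _.
  by rewrite /E1; move: b1; lra.
have hp2 : dist 0 (2^-1 *: p) <= 1 by rewrite distZ0 gtr0_norm ?invr_gt0 //; lra.
have h00 : dist 0 (0 : 'rV[R]_d) <= 1 by rewrite dist_refl.
have v0 : v 0 = 0.
  apply/eqP; rewrite -normr_le0; have := vN 0.
  by rewrite dist_refl powR0 ?mulr0 // gt_eqF //; move: eta12; lra.
have k1 := K p p1; have k2 := K _ hp2; have k3 := K _ h00.
have k4 := H3 v N r p cv r1 N0 p1 vN.
have ms : 0 <= m * sg := mulr_ge0 (ltW m0) (ltW sg0).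
have n1 : M2 * (N * e `^ eta) <= N * (m * sg / 8).
  rewrite mulrCA ler_wpM2l //.
  apply: (@le_trans _ _ (M2 * (m * sg / (8 * (M2 + 1))))); first by rewrite ler_wpM2l.
  rewrite mulrA ler_pdivrMr ?mulr_gt0 //.
  rewrite (_ : m * sg / 8 * _ = (M2 + 1) * (m * sg)); last by field.
  by rewrite ler_wpM2r // lerDl.
have n2 : M3 * N * r `^ (eta - 2) <= N * (m * sg / 2).
  rewrite (_ : M3 * N * _ = N * (M3 * r `^ (eta - 2))); last by ring.
  rewrite ler_wpM2l //.
  apply: (@le_trans _ _ (M3 * (m * sg / (2 * (M3 + 1))))); first by rewrite ler_wpM2l.
  rewrite mulrA ler_pdivrMr ?mulr_gt0 //.
  rewrite (_ : m * sg / 2 * _ = (M3 + 1) * (m * sg)); last by field.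
  by rewrite ler_wpM2r // lerDl.
have main : m * `|v p - 2 * v (2^-1 *: p)| <= N * (m * sg) + 4 * E1 * (A + B).
  rewrite -[m in m * _]gtr0_norm // -normrM.
  move: k1 k2 k3 k4 n1 n2; rewrite v0 mulr0.
  move: (kern _ _ p _) (kern _ _ (2^-1 *: p) _) (kern _ _ 0 _) => a1 a2 a3.
  move: (M2 * _) (M3 * _ * _) => n t k1 k2 k3 k4 n1 n2.
  have -> : m * (v p - 2 * v (2^-1 *: p)) = m * v p - 2 * (m * v (2^-1 *: p)) by ring.
  move: (m * v p) (m * v _) k1 k2 k3 k4 => x1 x2.
  rewrite !ler_norml => /andP[k11 k12] /andP[k21 k22] /andP[k31 k32] /andP[k41 k42].
  apply/andP; split; lra.
have half : `|v (2^-1 *: p)| <= N * 2^-1 `^ eta.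
  apply: le_trans (vN _) _; rewrite ler_wpM2l // distZ0 gtr0_norm ?invr_gt0 //.
  apply: ge0_ler_powR; rewrite ?nnegrE ?mulr_ge0 ?invr_ge0 ?dist0_ge0 //.
  by rewrite ler_piMr.
have main2 : `|v p - 2 * v (2^-1 *: p)| <= N * sg + 4 * E1 / m * (A + B).
  rewrite -(ler_pM2l m0); apply: le_trans main _.
  by rewrite le_eqVlt; apply/orP; left; apply/eqP; field; rewrite gt_eqF.
have -> : v p = (v p - 2 * v (2^-1 *: p)) + 2 * v (2^-1 *: p) by ring.
apply: le_trans (ler_normD _ _) _; rewrite normrM (ger0_norm (_ : 0 <= 2 :> R)) //.
apply: le_trans (lerD main2 (ler_wpM2l (ler0n R 2) half)) _; rewrite /th.
move: (4 * E1 / m * (A + B)) (2^-1 `^ eta) (sg) => c w s.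
by rewrite le_eqVlt; apply/orP; left; apply/eqP; ring.
Qed.

End core.

(** * From unit scale to all scales *)

Section real_germs.
Variables (R : realType) (d : nat) (alpha eta : R).
Hypothesis alpha01 : 0 < alpha < 1.
Hypothesis eta12 : 1 < eta < 2.
Implicit Types (x y z p q w : 'rV[R]_d).
Local Notation lap_prof := (@lap_prof R d).

(** The real-valued form of the hypotheses. Of the Laplacian only the averages against [lap_prof]
    centred at the base point are kept, and of the polynomials only [midaff]. *)
Definition germ_bounds (A B : R) (u : 'rV[R]_d -> 'rV[R]_d -> R) :=
  [/\ forall x, continuous (u x),
    forall x y, exists2 P, midaff P & forall z, `|u x z - u y z - P z| <=
      B * dist y z `^ alpha * (dist x y + dist y z) `^ (eta - alpha) &
    forall x l, 0 < l -> `|kern lap_prof (u x) x l| <= A * l `^ eta].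

Lemma dist_subr x w : dist 0 (w - x) = dist x w.
Proof. by apply: eq_bigr => i _; rewrite !mxE sub0r opprB. Qed.

Lemma dist_scale r x p q : 0 <= r -> dist (r *: p + x) (r *: q + x) = r * dist p q.
Proof.
move=> r0; rewrite /dist mulr_sumr; apply: eq_bigr => i _; rewrite !mxE.
by rewrite -[r in RHS]ger0_norm // -normrM; congr `|_|; ring.
Qed.

Lemma dist_base r x p : 0 <= r -> dist x (r *: p + x) = r * dist 0 p.
Proof. by move=> r0; have := dist_scale x 0 p r0; rewrite scaler0 add0r. Qed.

Lemma midaff_scale a r x P : midaff P -> midaff (fun z => a * P (r *: z + x)).
Proof.
move=> [cP mP]; split.
  by apply: contM; [exact: contcst | exact: (@cont_aff _ _ P r x cP)].
move=> p y; rewrite -mulrDr mulrCA; congr (_ * _).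
rewrite -(mP _ (r *: y)); congr (P _ + P _); first by rewrite scalerDr addrAC.
by rewrite scalerBr addrAC.
Qed.

(** All three bounds are homogeneous of degree eta, so rescaling by r leaves A, B and N unchanged.
    For |p| <= 1 the base points x and x + r p are at distance at most r, whence the 1 in
    [1 + dist p z]. *)
Lemma germ_bounds_rescale A B N u x r : 0 <= B -> 0 <= N -> 0 < r ->
  germ_bounds A B u -> (forall x y, `|u x y| <= N * dist x y `^ eta) ->
  split_at alpha eta A B N (fun z => (r `^ eta)^-1 * u x (r *: z + x)).
Proof.
move=> B0 N0 r0 [cu pu ku] uN p p1; have rr0 := ltW r0.
have re0 : 0 < r `^ eta by rewrite powR_gt0.
have [P mP rem] := pu x (r *: p + x).
exists (fun z => (r `^ eta)^-1 * u (r *: p + x) (r *: z + x)), (fun z => (r `^ eta)^-1 * P (r *: z + x)).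
have cV : continuous (fun z => u (r *: p + x) (r *: z + x)).
  exact: (@cont_aff _ _ (u (r *: p + x)) r x (cu _)).
split.
- by apply: contM => //; exact: contcst.
- exact: midaff_scale.
- move=> z; rewrite normrM gtr0_norm ?invr_gt0 // mulrC ler_pdivrMr //.
  apply: le_trans (uN _ _) _; rewrite dist_scale // powRM ?sumr_ge0 //.
  by rewrite le_eqVlt; apply/orP; left; apply/eqP; ring.
- move=> z; rewrite -!mulrBr normrM gtr0_norm ?invr_gt0 // mulrC ler_pdivrMr //.
  apply: le_trans (rem _) _; rewrite dist_scale //.
  have -> : dist x (r *: p + x) = r * dist 0 p.
    exact: dist_base.
  have ea0 : 0 <= eta - alpha by move: alpha01 eta12; lra.
  have dz : 0 <= dist p z by rewrite sumr_ge0.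
  have dp : 0 <= dist 0 p by rewrite sumr_ge0.
  apply: (@le_trans _ _ (B * (r * dist p z) `^ alpha * (r * (1 + dist p z)) `^ (eta - alpha))).
    rewrite ler_wpM2l ?mulr_ge0 ?powR_ge0 // ge0_ler_powR // ?nnegrE.
    + by rewrite addr_ge0 ?mulr_ge0.
    + by rewrite mulr_ge0 ?addr_ge0.
    + by rewrite -mulrDr ler_wpM2l // lerD2r.
  rewrite !powRM ?addr_ge0 //.
  have -> : r `^ eta = r `^ alpha * r `^ (eta - alpha).
    by rewrite -powRD ?(gt_eqF r0) ?implybT // addrC subrK.
  by rewrite le_eqVlt; apply/orP; left; apply/eqP; ring.
- move=> l l0.
  rewrite kernZ //; last exact: radial_profile_lap_prof.
  have -> : kern lap_prof (fun z => u (r *: p + x) (r *: z + x)) p l =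
      kern lap_prof (u (r *: p + x)) (r *: p + x) (r * l).
    rewrite !kern_change ?mulr_gt0 //; try exact: radial_profile_lap_prof.
    congr intRd; apply/funext => z; congr (u _ _ * _).
    by rewrite scalerDr scalerA addrA.
  rewrite normrM gtr0_norm ?invr_gt0 // mulrC ler_pdivrMr //.
  apply: le_trans (ku _ _ _) _; rewrite ?mulr_gt0 // powRM ?(ltW l0) //.
  by rewrite le_eqVlt; apply/orP; left; apply/eqP; ring.
Qed.

(** The unit-scale estimate at r = dist x y improves any admissible constant M to th M + E.
    Iterating from the finite N and letting the number of steps tend to infinity, at fixed x and y,
    leaves the fixed point E / (1 - th). *)
Lemma germ_bounds_bound : exists2 C : R, 0 <= C & forall A B N u, 0 <= A -> 0 <= B -> 0 <= N ->
  germ_bounds A B u -> (forall x y, `|u x y| <= N * dist x y `^ eta) ->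
  forall x y, `|u x y| <= C * (A + B) * dist x y `^ eta.
Proof.
have [th [C [/andP[th0 th1] C0 H]]] := unit_scale d alpha01 eta12.
have s0 : 0 < 1 - th by rewrite subr_gt0.
have en0 : eta != 0 by rewrite gt_eqF //; move: eta12; lra.
exists (C / (1 - th)); first by rewrite divr_ge0 // ltW.
move=> A B N u A0 B0 N0 gu uN; have [cu _ _] := gu.
pose E := C * (A + B).
have E0 : 0 <= E by rewrite mulr_ge0 // addr_ge0.
have step M : 0 <= M -> (forall x y, `|u x y| <= M * dist x y `^ eta) ->
    forall x y, `|u x y| <= (th * M + E) * dist x y `^ eta.
  move=> M0 uM x y.
  have r0 : 0 <= dist x y by rewrite sumr_ge0.
  have [r00|rn] := eqVneq (dist x y) 0.
    by have := uM x y; rewrite r00 powR0 // !mulr0.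
  have rp : 0 < dist x y by rewrite lt_neqAle eq_sym rn.
  set r := dist x y in r0 rn rp *.
  have rep : 0 < r `^ eta by rewrite powR_gt0.
  have sv := germ_bounds_rescale x B0 M0 rp gu uM.
  pose p := r^-1 *: (y - x).
  have p1 : dist 0 p <= 1.
    by rewrite distZ0 dist_subr gtr0_norm ?invr_gt0 // mulVf.
  have cv : continuous (fun z => (r `^ eta)^-1 * u x (r *: z + x)).
    apply: contM; first exact: contcst.
    exact: (@cont_aff _ _ (u x) r x (cu _)).
  have := H _ A B M p A0 B0 M0 cv sv _ p1.
  have -> : r *: p + x = y by rewrite scalerA divff // scale1r subrK.
  rewrite normrM (gtr0_norm (_ : 0 < (r `^ eta)^-1)) ?invr_gt0 // mulrC ler_pdivrMr //.
  apply=> z; rewrite normrM gtr0_norm ?invr_gt0 // mulrC ler_pdivrMr //.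
  apply: le_trans (uM _ _) _; rewrite dist_base //.
  rewrite powRM ?sumr_ge0 //.
  by rewrite le_eqVlt; apply/orP; left; apply/eqP; ring.
have iter k : forall x y, `|u x y| <= (th ^+ k * N + E / (1 - th)) * dist x y `^ eta.
  elim: k => [|k IH] x y.
    apply: le_trans (uN x y) _; rewrite ler_wpM2r ?powR_ge0 //.
    by rewrite expr0 mul1r lerDl divr_ge0 // ltW.
  have M0 : 0 <= th ^+ k * N + E / (1 - th).
    by apply: addr_ge0; [rewrite mulr_ge0 ?exprn_ge0 | rewrite divr_ge0 // ltW].
  apply: le_trans (step _ M0 IH x y) _; rewrite ler_wpM2r ?powR_ge0 //.
  rewrite le_eqVlt; apply/orP; left; apply/eqP; rewrite exprS; field.
  by rewrite gt_eqF.
move=> x y; apply/ler_addgt0Pr => e e0.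
have [k hk] : exists k, th ^+ k * (N * dist x y `^ eta) <= e.
  pose T := N * dist x y `^ eta.
  have T0 : 0 <= T by rewrite mulr_ge0 ?powR_ge0.
  have T1 : 0 < T + 1 by rewrite ltr_wpDl.
  have /cvgrPdist_lt /(_ (e / (T + 1))) : th ^+ n @[n --> \oo] --> (0 : R).
    by apply: cvg_expr; rewrite ger0_norm.
  rewrite divr_gt0 // => /(_ isT) [k _ /(_ k (leqnn k))].
  rewrite sub0r normrN ger0_norm ?exprn_ge0 // => hk.
  exists k; apply: (@le_trans _ _ (e / (T + 1) * T)); first by rewrite ler_wpM2r // ltW.
  by rewrite mulrAC ler_pdivrMr // ler_wpM2l ?(ltW e0) // lerDl.
apply: le_trans (iter k x y) _.
rewrite mulrDl -mulrA addrC /E; apply: lerD => //.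
by rewrite le_eqVlt; apply/orP; left; apply/eqP; ring.
Qed.

End real_germs.

(** * Real and imaginary parts of germs and polynomials *)

Section complex_germs.
Variables (R : realType) (d : nat).
Implicit Types (x y z p q w : 'rV[R]_d).
Local Open Scope complex_scope.

Lemma normc_Re (c : R[i]) : `|complex.Re c| <= Normc.normc c.
Proof.
case: c => a b /=; rewrite -sqrtr_sqr ler_wsqrtr // lerDl sqr_ge0 //.
Qed.

Lemma normc_Im (c : R[i]) : `|complex.Im c| <= Normc.normc c.
Proof.
case: c => a b /=; rewrite -sqrtr_sqr ler_wsqrtr // lerDr sqr_ge0 //.
Qed.

Lemma normc_ReIm (c : R[i]) : Normc.normc c <= `|complex.Re c| + `|complex.Im c|.
Proof.
case: c => a b /=.
have s0 : 0 <= `|a| + `|b| by rewrite addr_ge0.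
rewrite -[leRHS]ger0_norm // -sqrtr_sqr ler_wsqrtr //.
rewrite -[a ^+ 2]real_normK ?num_real // -[b ^+ 2]real_normK ?num_real //.
by rewrite sqrrD; have := mulr_ge0 (normr_ge0 a) (normr_ge0 b); lra.
Qed.

Lemma midaff_cst (a : R) : midaff (fun _ : 'rV[R]_d => a).
Proof. by split; [exact: contcst | move=> p y; ring]. Qed.

Lemma midaff_coord i : midaff (fun z : 'rV[R]_d => z 0 i).
Proof. by split; [exact: cont_coord | move=> p y; rewrite !mxE; ring]. Qed.

Lemma midaffD (P Q : 'rV[R]_d -> R) : midaff P -> midaff Q -> midaff (fun z => P z + Q z).
Proof.
move=> [cP mP] [cQ mQ]; split; first exact: contD.
by move=> p y; rewrite mulrDr -(mP p y) -(mQ p y); ring.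
Qed.

Lemma midaffZ a (P : 'rV[R]_d -> R) : midaff P -> midaff (fun z => a * P z).
Proof.
move=> [cP mP]; split; first by apply: contM => //; exact: contcst.
by move=> p y; rewrite mulrCA -(mP p y); ring.
Qed.

Definition midaffC (f : 'rV[R]_d -> R[i]) :=
  midaff (fun z => complex.Re (f z)) /\ midaff (fun z => complex.Im (f z)).

Lemma midaffC_sum (I : Type) (r : seq I) (S : pred I) (F : I -> 'rV[R]_d -> R[i]) :
  (forall i, S i -> midaffC (F i)) -> midaffC (fun z => \sum_(i <- r | S i) F i z).
Proof.
move=> mF; elim: r => [|i r [IH1 IH2]].
  by split; rewrite (_ : (fun _ => _) = fun=> 0); try exact: midaff_cst;
    apply/funext => z; rewrite big_nil.
have [Si|Si] := boolP (S i); last first.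
  by split; [move: IH1 | move: IH2]; congr midaff; apply/funext => z; rewrite big_cons (negbTE Si).
have [m1 m2] := mF i Si.
split; [have := midaffD m1 IH1 | have := midaffD m2 IH2]; congr midaff;
  apply/funext => z; rewrite big_cons Si; by case: (F i z) => a b; case: (\sum_(_ <- _ | _) _).
Qed.

(** A monomial of degree at most one is a constant or a multiple of a single coordinate. *)
Lemma midaff_monomial (c : R[i]) (b : 'I_d -> nat) : (\sum_i b i <= 1)%N ->
  midaffC (fun z => c * \prod_(i < d) ((z 0 i)%:C) ^+ b i).
Proof.
move=> b1; have [/forallP b0|] := boolP [forall i, b i == 0%N].
  rewrite (_ : (fun _ => _) = fun=> c); first by split; exact: midaff_cst.
  by apply/funext => z; rewrite big1 ?mulr1 // => i _; rewrite (eqP (b0 i)) expr0.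
rewrite negb_forall => /existsP[j bj].
have bs := b1; rewrite (bigD1 j) //= in bs.
have bj1 : b j = 1%N by move: bj bs; case: (b j) => [|[|?]].
rewrite bj1 -[X in (_ <= X)%N]addn0 leq_add2l leqn0 sum_nat_eq0 in bs.
have e z : c * \prod_(i < d) ((z 0 i)%:C) ^+ b i = c * (z 0 j)%:C.
  rewrite (bigD1 j) //= bj1 expr1 big1 ?mulr1 // => i ij.
  by move/forallP: bs => /(_ i); rewrite ij /= => /eqP ->; rewrite expr0.
case: c e => a1 a2 e.
split; [have := midaffZ a1 (midaff_coord j) | have := midaffZ a2 (midaff_coord j)];
  congr midaff; apply/funext => z; rewrite e /=; ring.
Qed.

(** The degree stays a variable with an equation because in use it is the floor of [eta], equal to 1
    only by a proof. *)
Lemma midaff_poly k (c : {ffun 'I_d -> 'I_k.+1} -> R[i]) : k = 1%N -> midaffC (Defs.polyP c).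
Proof. by move=> k1; subst k; apply: midaffC_sum => b; exact: midaff_monomial. Qed.

End complex_germs.

(** * Assembling the estimate for complex germs *)

Section main.
Variables (R : realType) (d : nat) (alpha eta : R).
Hypothesis alpha01 : 0 < alpha < 1.
Hypothesis eta12 : 1 < eta < 2.
Implicit Types (U : 'rV[R]_d -> 'rV[R]_d -> R[i]).

Lemma floor_eta : `|Num.floor eta|%N = 1%N.
Proof.
rewrite (@floor_def _ eta 1) //.
by rewrite intrD mulr1z; move: eta12; lra.
Qed.

Lemma ceil_eta : absz (Num.ceil `|eta - 2|) = 1%N.
Proof.
rewrite (@ceil_def _ _ 1) // subrr mulr0z mulr1z ler0_norm; last by move: eta12; lra.
by move: eta12; lra.
Qed.

(** A supremum over the empty set would be -oo; the bump provides an actual test function. *)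
Lemma seminormG_ge0 U : (0 <= seminormG (eta - 2) (lapGerm U))%E.
Proof.
have [k k0 tk] := @testB_bump R d.
apply: le_trans (ereal_sup_ubound _); last first.
  by exists (fun x => k * cbump (test_cut R d) 1 (sq x)), 0, 1; split; [rewrite ceil_eta | exact: ltr01 | reflexivity].
rewrite lee_fin mulr_ge0 ?powR_ge0 //.
exact: le_trans (normr_ge0 _) (normc_Re _).
Qed.

Lemma seminormGA_ge0 U : (0 <= seminormGA eta alpha U)%E.
Proof.
by apply: le_ereal_inf_tmp => _ [M [M0 _] <-]; rewrite lee_fin ltW.
Qed.

(** The constant undoes the normalisation of the test function, and l^(2 - eta) l^eta cancels the
    l^-2 of the Laplacian. Test functions are real, so real and imaginary parts of the pairing are
    the pairings of the parts. *)
Lemma lapGerm_kern : exists2 k : R, 0 < k & forall U a, germ U ->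
  (seminormG (eta - 2) (lapGerm U) <= a%:E)%E -> forall x l, 0 < l ->
  `|kern (@lap_prof R d) (fun y => complex.Re (U x y)) x l| <= k * a * l `^ eta /\
  `|kern (@lap_prof R d) (fun y => complex.Im (U x y)) x l| <= k * a * l `^ eta.
Proof.
have [k k0 tk] := @testB_bump R d.
exists k^-1; first by rewrite invr_gt0.
move=> U a gU Ua x l l0.
set phi := fun x => k * cbump (test_cut R d) 1 (sq x) in tk.
have bnd : l `^ (- (eta - 2)) * Normc.normc (lapGerm U x (rescale phi x l)) <= a.
  rewrite -lee_fin; apply: le_trans Ua; apply: ereal_sup_ubound.
  by exists phi, x, l; split; rewrite ?ceil_eta.
have l2 : l `^ (- (eta - 2)) * l `^ eta = l ^+ 2.
  rewrite -powRD; last by rewrite (gt_eqF l0) implybT.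
  by rewrite (_ : _ + _ = 2); [rewrite powR_mulrn // ltW | ring].
have lp : 0 < l `^ (- (eta - 2)) by rewrite powR_gt0.
have conv (v : 'rV[R]_d -> R) : continuous v ->
    intRd (fun y => v y * laplace (rescale phi x l) y) =
    - (k * l ^- 2) * kern (@lap_prof R d) v x l.
  move=> cv; rewrite /kern -intRdZ; last exact: kern_csupp (radial_profile_lap_prof R d) cv l0.
  congr intRd; apply/funext => y; rewrite laplace_bump // -addn2 exprD.
  move: (lap_prof _) => b; field.
  by rewrite expf_neq0 gt_eqF.
have fin (w : R) (v : 'rV[R]_d -> R) : continuous v -> w = intRd (fun y => v y * laplace (rescale phi x l) y) ->
    `|w| <= Normc.normc (lapGerm U x (rescale phi x l)) ->
    `|kern (@lap_prof R d) v x l| <= k^-1 * a * l `^ eta.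
  have kl : 0 < k * l ^- 2 by rewrite mulr_gt0 // invr_gt0 exprn_gt0.
  move=> cv -> ; rewrite conv // normrM normrN (gtr0_norm kl).
  rewrite -(ler_pM2l lp) => /le_trans /(_ bnd); rewrite mulrA.
  move: (`|kern _ _ _ _|) => w0 h.
  rewrite -(ler_pM2l (mulr_gt0 lp kl)); apply: le_trans h _.
  rewrite (_ : l `^ (- (eta - 2)) * (k / l ^+ 2) * (k^-1 * a * l `^ eta) =
    (l `^ (- (eta - 2)) * l `^ eta) / l ^+ 2 * a); last first.
    by field; rewrite !gt_eqF.
  by rewrite l2 divff ?mul1r // expf_neq0 // gt_eqF.
have [c1 c2] := gU x.
set c := lapGerm U x (rescale phi x l) in fin.
by split; [exact: (fin _ _ c1 erefl (normc_Re c)) | exact: (fin _ _ c2 erefl (normc_Im c))].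
Qed.

Lemma germ_estimate : exists2 C : R, 0 < C & forall U a B N, germ U ->
  0 <= a -> 0 < B -> 0 < N ->
  (forall x y, Normc.normc (U x y) <= N * dist x y `^ eta) ->
  (seminormG (eta - 2) (lapGerm U) <= a%:E)%E ->
  (forall x y, exists c : {ffun 'I_d -> 'I_(`|Num.floor eta|%N).+1} -> R[i],
       forall z, Normc.normc (U x z - U y z - Defs.polyP c z)
          <= B * dist y z `^ alpha * (dist x y + dist y z) `^ (eta - alpha)) ->
  forall x y, Normc.normc (U x y) <= C * (a + B) * dist x y `^ eta.
Proof.
have [C C0 H] := germ_bounds_bound d alpha01 eta12.
have [k k0 K] := lapGerm_kern.
(* Dominates the sum of the two bounds C (k a + B); the final 1 makes it strictly positive, [C]
   being only nonnegative. *)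
exists (2 * C * (k + 1) + 1); first by rewrite ltr_wpDl // mulr_ge0 ?mulr_ge0 // addr_ge0 // ltW.
move=> U a B N gU a0 B0 N0 UN Ua UB x y.
have ka := K U a gU Ua.
have ka0 : 0 <= k * a by rewrite mulr_ge0 // ltW.
have hR : `|complex.Re (U x y)| <= C * (k * a + B) * dist x y `^ eta.
  apply: (H (k * a) B N (fun x y => complex.Re (U x y)) ka0 (ltW B0) (ltW N0)).
    split; [by move=> z; exact: (gU z).1 | | by move=> z l l0; exact: (ka z l l0).1].
    move=> x' y'; have [c hc] := UB x' y'.
    exists (fun z => complex.Re (Defs.polyP c z)); first exact: (midaff_poly c floor_eta).1.
    move=> z; apply: le_trans (hc z); apply: le_trans (normc_Re _).
    by case: (U x' z) (U y' z) (Defs.polyP c z) => [a1 a2] [b1 b2] [c1 c2].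
  by move=> x' y'; exact: le_trans (normc_Re _) (UN x' y').
have hI : `|complex.Im (U x y)| <= C * (k * a + B) * dist x y `^ eta.
  apply: (H (k * a) B N (fun x y => complex.Im (U x y)) ka0 (ltW B0) (ltW N0)).
    split; [by move=> z; exact: (gU z).2 | | by move=> z l l0; exact: (ka z l l0).2].
    move=> x' y'; have [c hc] := UB x' y'.
    exists (fun z => complex.Im (Defs.polyP c z)); first exact: (midaff_poly c floor_eta).2.
    move=> z; apply: le_trans (hc z); apply: le_trans (normc_Im _).
    by case: (U x' z) (U y' z) (Defs.polyP c z) => [a1 a2] [b1 b2] [c1 c2].
  by move=> x' y'; exact: le_trans (normc_Im _) (UN x' y').
apply: le_trans (normc_ReIm _) _; apply: le_trans (lerD hR hI) _.
rewrite -mulrDl ler_wpM2r ?powR_ge0 //.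
have e1 : 0 <= C * a by rewrite mulr_ge0.
have e2 : 0 <= C * (k * B) by rewrite mulr_ge0 // mulr_ge0 // ltW.
rewrite (_ : (2 * C * (k + 1) + 1) * (a + B) =
  (C * (k * a + B) + C * (k * a + B)) + 2 * (C * a) + 2 * (C * (k * B)) + a + B); last by ring.
by move: (C * (k * a + B)) (C * a) (C * (k * B)) e1 e2 => t1 t2 t3 e1 e2; move: a0 B0; lra.
Qed.

End main.

Theorem theorem2p8 (R : realType) (d : nat) (alpha eta : R) :
  0 < alpha < 1 -> 1 < eta < 2 ->
  exists C : R, 0 < C /\
    forall U : 'rV[R]_d -> 'rV[R]_d -> R[i],
      germ U -> (normG eta U < +oo)%E ->
      (normG eta U <= C%:E * (seminormG (eta - 2) (lapGerm U)
                               + seminormGA eta alpha U))%E.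
Proof.
move=> alpha01 eta12; have [C C0 H] := germ_estimate d alpha01 eta12.
exists C; split=> // U gU /ereal_inf_lt [_ [N [N0 UN] <-] _].
have G0 := seminormG_ge0 eta12 U; have A0 := seminormGA_ge0 alpha eta U.
(* If either seminorm is infinite, nonnegativity of the other and positivity of [C] make the
   right-hand side +oo. *)
move: G0 A0; case EG : (seminormG _ _) => [a| |] //; last first.
  move=> _; case: (seminormGA _ _ _) => [b| |] // _; rewrite ?addye // gt0_muley ?lte_fin ?leey //.
case EA : (seminormGA _ _ _) => [b| |] //; last first.
  by move=> _ _; rewrite addey // gt0_muley ?lte_fin ?leey.
rewrite !lee_fin => a0 b0; apply/lee_addgt0Pr => e e0.
(* The infimum may not be attained; an admissible [B] within e / C of it costs only [e] in the end.
   The supremum [a], by contrast, is used directly. *)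
have [B [B0 UB] Bb] : exists2 B : R, (0 < B /\ forall x y,
    exists c : {ffun 'I_d -> 'I_(`|Num.floor eta|%N).+1} -> R[i],
       forall z, Normc.normc (U x z - U y z - Defs.polyP c z)
          <= B * dist y z `^ alpha * (dist x y + dist y z) `^ (eta - alpha)) & B <= b + e / C.
  have : (seminormGA eta alpha U < (b + e / C)%:E)%E.
    by rewrite EA lte_fin ltrDl divr_gt0.
  by move/ereal_inf_lt => [_ [B hB <-] Bb]; exists B => //; rewrite -lee_fin ltW.
have Ua : (seminormG (eta - 2) (lapGerm U) <= a%:E)%E by rewrite EG.
have est := H U a B N gU a0 B0 N0 UN Ua UB.
apply: (@le_trans _ _ (C * (a + B))%:E).
  apply: ereal_inf_lbound; exists (C * (a + B)) => //; split => //.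
  by rewrite mulr_gt0 // ltr_wpDl.
rewrite -(EFinD a b) -(EFinM C (a + b)) -(EFinD _ e) lee_fin.
have : C * B <= C * (b + e / C) by rewrite ler_pM2l.
by rewrite [C * (b + _)]mulrDr [C * (e / C)]mulrCA divff ?gt_eqF // mulr1 !mulrDr; lra.
Qed.
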